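(* Let $0<d<\pi/2$ and let $\mathscr{D}_d=\{\zeta\in\mathbb{C}:|\Im\zeta|<d\}$, $\mathscr{D}_d^{-}=\{\zeta\in\mathscr{D}_d:\Re\zeta<0\}$, $\mathscr{D}_d^{+}=\{\zeta\in\mathscr{D}_d:\Re\zeta\ge 0\}$. Let $\psi(t)=\sinh t$. Assume $f$ is analytic on $\psi(\mathscr{D}_d)$ and there are constants $K,\alpha,\beta>0$ such that $|f(z)|\le K\,|1+z^2|^{-(\alpha+1)/2}$ for all $z\in\psi(\mathscr{D}_d^{-})$ and $|f(z)|\le K\,|1+z^2|^{-(\beta+1)/2}$ for all $z\in\psi(\mathscr{D}_d^{+})$. Let $\mu=\min\{\alpha,\beta\}$, $\nu=\max\{\alpha,\beta\}$, let $n$ be a positive integer, $h=\sqrt{2\pi d/(\mu n)}$, and let $M=n$, $N=\lceil \alpha n/\beta\rceil$ if $\mu=\alpha$, and $N=n$, $M=\lceil\beta n/\alpha\rceil$ if $\mu=\beta$. Then \[ \left|\int_{-\infty}^{\infty} f(t)\,dt-h\sum_{k=-M}^{N} f(\psi(kh))\psi'(kh)\right|\le C_1\,e^{-\sqrt{2\pi d\mu n}}, \qquad C_1=\frac{2^{\nu+1}K}{\mu}\left\{\frac{2}{(1-e^{-\sqrt{2\pi d\mu}})(\cos d)^{\nu}}+1\right\}. \]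
   Context: $\psi(\mathscr{D}_d)=\{\psi(\zeta):\zeta\in\mathscr{D}_d\}$ denotes the image of the strip; similarly for $\mathscr{D}_d^{\pm}$. Powers of complex quantities are taken as moduli, so all bounds are real. *)

(* Defs.v *)
From Stdlib Require Export Reals ZArith.
From Coquelicot Require Export Coquelicot.
Open Scope R_scope.

Definition csinh (z : C) : C :=
  (sinh (fst z) * cos (snd z), cosh (fst z) * sin (snd z)).

Definition strip (d : R) (z : C) : Prop := Rabs (Im z) < d.
Definition strip_minus (d : R) (z : C) : Prop := strip d z /\ Re z < 0.
Definition strip_plus (d : R) (z : C) : Prop := strip d z /\ 0 <= Re z.

Definition C_differentiable (f : C -> C) (z : C) : Prop :=
  @ex_derive C_AbsRing C_NormedModule f z.

Definition analytic_on_sinh_strip (d : R) (f : C -> C) : Prop :=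
  forall zeta : C, strip d zeta -> C_differentiable f (csinh zeta).

Definition Rceil (x : R) : Z := (- (up (- x) - 1))%Z.

Definition sum_MN (M N : nat) (g : Z -> C) : C :=
  sum_n (fun j : nat => g (Z.of_nat j - Z.of_nat M)%Z) (M + N).

Definition trunc_M (alpha beta : R) (n : nat) : nat :=
  if Rle_dec alpha beta then n else Z.to_nat (Rceil (beta * INR n / alpha)).
Definition trunc_N (alpha beta : R) (n : nat) : nat :=
  if Rle_dec alpha beta then Z.to_nat (Rceil (alpha * INR n / beta)) else n.

(* Main.v *)
Require Import Defs.
From Stdlib Require Import Lra Lia Psatz Classical.

(** With F(z) = f(sinh z) cosh z, the integral of f is the integral of F along
    the real axis, and |F(x + iy)| <= K 2^nu (cos d)^(-nu) e^(-mu |x|) in the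
    strip. The kernel ker(z) = 1 / (1 - e^(-2 pi i z / h)) has its poles at the
    nodes kh, so Cauchy's theorem on the cell around kh expresses
    h F(kh) - (integral of F over the cell) through integrals over the lines
    Im z = -e and Im z = e, where |ker - 1|, respectively |ker|, is at most
    1 / (e^(2 pi e / h) - 1), plus integrals over the vertical sides, which
    telescope from cell to cell. Let the number of cells go to infinity, then
    let e tend to d, and add the geometric tails of the truncated series.
    Holomorphy is only assumed pointwise, so Cauchy's theorem is proved by
    Goursat's bisection. *)

(** * Complex differentiability *)

(** The step h is the one for which 2 pi d / h and mu n h are the same number s, so that the error
    of the infinite sum and both truncation errors decay like e^(-s). The two summands of C_1 keep
    these sources apart. The two lines together give 4 B / mu times 1 / (e^(2 pi e / h) - 1), where
    B = K 2^nu / (cos d)^nu and 2 / mu bounds the integral of e^(-mu |x|); after the limit in e, n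
    >= 1 allows 1 - e^(-s) to be replaced by its smaller value at n = 1. The truncated terms sit on
    the real axis, where the cosine factor is 1, and cost 2^(nu+1) K / mu times e^(-s).

    The limit in e is forced because f is controlled on the open strip only. The cells are cut
    midway between the nodes: there the kernel has no pole, and by its period h it takes equal
    values on opposite sides, which is what lets the vertical integrals telescope. Convergence of
    the integral of f is not assumed but proved, with a rate that also serves in the comparison with
    finitely many cells. *)

Definition ccont (f : C -> C) (z : C) : Prop :=
  forall eps, 0 < eps -> exists del, 0 < del /\
    forall u, Cmod (u - z) < del -> Cmod (f u - f z) < eps.

(* Caratheodory's form of differentiability, which turns the calculus rules into algebra. *)
Definition cdiff (f : C -> C) (z : C) : Prop :=
  exists phi, ccont phi z /\ exists del, 0 < del /\
    forall u, Cmod (u - z) < del -> (f u = f z + phi u * (u - z))%C.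

Lemma Ceq_ext (u v : C) : Re u = Re v -> Im u = Im v -> u = v.
Proof. destruct u, v; unfold Re, Im; simpl; intros; subst; reflexivity. Qed.

Ltac cring := apply Ceq_ext; unfold Re, Im; simpl; ring.

Lemma Cmod_sub_le (u v : C) : Cmod u - Cmod v <= Cmod (u - v).
Proof.
  assert (H := Cmod_triangle (u - v) v).
  replace (u - v + v)%C with u in H by ring. lra.
Qed.

Lemma Cmod_sum_le (u v : C) : Cmod (u - v) <= Cmod u + Cmod v.
Proof.
  unfold Cminus. rewrite <- (Cmod_opp v). apply Cmod_triangle.
Qed.

Lemma Cmod_pair_le (x y : R) : Cmod (x, y) <= Rabs x + Rabs y.
Proof.
  replace (x, y) with (RtoC x + Ci * RtoC y)%C by cring.
  eapply Rle_trans; [apply Cmod_triangle|].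
  rewrite Cmod_mult, Cmod_Ci, !Cmod_R. lra.
Qed.

Lemma Im_le_Cmod (z : C) : Rabs (Im z) <= Cmod z.
Proof.
  eapply Rle_trans; [|apply Rmax_Cmod]. apply Rmax_r.
Qed.

Lemma ccont_const (c z : C) : ccont (fun _ => c) z.
Proof.
  intros eps He; exists 1; split; [lra|]; intros u _.
  replace (c - c)%C with (RtoC 0) by ring. rewrite Cmod_0; lra.
Qed.

Lemma ccont_id (z : C) : ccont (fun u => u) z.
Proof. intros eps He; exists eps; split; auto. Qed.

Lemma ccont_ext_loc (f g : C -> C) (z : C) (del : R) : 0 < del ->
  (forall u, Cmod (u - z) < del -> f u = g u) -> ccont f z -> ccont g z.
Proof.
  intros Hd H Hf eps He. destruct (Hf eps He) as [d [Hd1 Hd2]].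
  exists (Rmin d del). split; [apply Rmin_glb_lt; lra|].
  intros u Hu. rewrite <- !H.
  - apply Hd2. eapply Rlt_le_trans; [apply Hu|apply Rmin_l].
  - replace (z - z)%C with (RtoC 0) by ring. rewrite Cmod_0; lra.
  - eapply Rlt_le_trans; [apply Hu|apply Rmin_r].
Qed.

Lemma ccont_plus (f g : C -> C) (z : C) :
  ccont f z -> ccont g z -> ccont (fun u => f u + g u)%C z.
Proof.
  intros Hf Hg eps He.
  destruct (Hf (eps/2)) as [d1 [Hd1 H1]]; [lra|].
  destruct (Hg (eps/2)) as [d2 [Hd2 H2]]; [lra|].
  exists (Rmin d1 d2). split; [apply Rmin_glb_lt; lra|].
  intros u Hu.
  replace (f u + g u - (f z + g z))%C with ((f u - f z) + (g u - g z))%C by ring.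
  eapply Rle_lt_trans; [apply Cmod_triangle|].
  assert (Cmod (f u - f z) < eps/2) by (apply H1; eapply Rlt_le_trans; [apply Hu|apply Rmin_l]).
  assert (Cmod (g u - g z) < eps/2) by (apply H2; eapply Rlt_le_trans; [apply Hu|apply Rmin_r]).
  lra.
Qed.

Lemma ccont_mult (f g : C -> C) (z : C) :
  ccont f z -> ccont g z -> ccont (fun u => f u * g u)%C z.
Proof.
  intros Hf Hg eps He.
  assert (Pf := Cmod_ge_0 (f z)). assert (Pg := Cmod_ge_0 (g z)).
  assert (P1 : 0 < eps / (2 * (Cmod (g z) + 1))) by (apply Rdiv_lt_0_compat; lra).
  assert (P2 : 0 < eps / (2 * (Cmod (f z) + 1))) by (apply Rdiv_lt_0_compat; lra).
  destruct (Hf _ P1) as [d1 [Hd1 H1]].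
  destruct (Hg (Rmin 1 (eps / (2 * (Cmod (f z) + 1))))) as [d2 [Hd2 H2]];
    [apply Rmin_glb_lt; lra|].
  exists (Rmin d1 d2). split; [apply Rmin_glb_lt; lra|].
  intros u Hu.
  assert (A1 : Cmod (f u - f z) < eps / (2 * (Cmod (g z) + 1)))
    by (apply H1; eapply Rlt_le_trans; [apply Hu|apply Rmin_l]).
  assert (A2 := H2 u ltac:(eapply Rlt_le_trans; [apply Hu|apply Rmin_r])).
  assert (A3 : Cmod (g u - g z) < 1) by (eapply Rlt_le_trans; [apply A2|apply Rmin_l]).
  assert (A4 : Cmod (g u - g z) < eps / (2 * (Cmod (f z) + 1)))
    by (eapply Rlt_le_trans; [apply A2|apply Rmin_r]).
  assert (A5 : Cmod (g u) < Cmod (g z) + 1) by (assert (T := Cmod_sub_le (g u) (g z)); lra).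
  replace (f u * g u - f z * g z)%C
    with ((f u - f z) * g u + f z * (g u - g z))%C by ring.
  eapply Rle_lt_trans; [apply Cmod_triangle|]. rewrite !Cmod_mult.
  assert (B1 : Cmod (f u - f z) * Cmod (g u) <= eps / (2 * (Cmod (g z) + 1)) * (Cmod (g z) + 1)).
  { apply Rmult_le_compat; try apply Cmod_ge_0; lra. }
  replace (eps / (2 * (Cmod (g z) + 1)) * (Cmod (g z) + 1)) with (eps/2) in B1 by (field; lra).
  assert (B2 : Cmod (f z) * Cmod (g u - g z) <= Cmod (f z) * (eps / (2 * (Cmod (f z) + 1)))).
  { apply Rmult_le_compat_l; lra. }
  assert (B3 : Cmod (f z) * (eps / (2 * (Cmod (f z) + 1))) < (Cmod (f z) + 1) * (eps / (2 * (Cmod (f z) + 1)))).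
  { apply Rmult_lt_compat_r; lra. }
  replace ((Cmod (f z) + 1) * (eps / (2 * (Cmod (f z) + 1)))) with (eps/2) in B3 by (field; lra).
  lra.
Qed.

Lemma ccont_comp (f g : C -> C) (z : C) :
  ccont g z -> ccont f (g z) -> ccont (fun u => f (g u)) z.
Proof.
  intros Hg Hf eps He. destruct (Hf eps He) as [d1 [Hd1 H1]].
  destruct (Hg d1 Hd1) as [d2 [Hd2 H2]]. exists d2; split; auto.
Qed.

Lemma ccont_inv (f : C -> C) (z : C) :
  f z <> 0 -> ccont f z -> ccont (fun u => / f u)%C z.
Proof.
  intros Hz Hf eps He.
  assert (Pm : 0 < Cmod (f z)) by (apply Cmod_gt_0; auto).
  set (m := Cmod (f z)) in *.
  destruct (Hf (Rmin (m/2) (eps * m * m / 2))) as [d [Hd H]].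
  { apply Rmin_glb_lt; [lra|]. assert (0 < eps * m * m) by (repeat apply Rmult_lt_0_compat; lra). lra. }
  exists d; split; auto. intros u Hu. specialize (H u Hu).
  assert (A1 : Cmod (f u - f z) < m/2) by (eapply Rlt_le_trans; [apply H|apply Rmin_l]).
  assert (A2 : Cmod (f u - f z) < eps * m * m / 2) by (eapply Rlt_le_trans; [apply H|apply Rmin_r]).
  assert (A3 : m / 2 < Cmod (f u)).
  { assert (T := Cmod_sub_le (f z) (f u)).
    replace (f z - f u)%C with (- (f u - f z))%C in T by ring. rewrite Cmod_opp in T. fold m in T. lra. }
  assert (Nu : f u <> 0) by (apply Cmod_gt_0; lra).
  replace (/ f u - / f z)%C with (- (f u - f z) * / (f u * f z))%C by (field; auto).
  rewrite Cmod_mult, Cmod_opp, Cmod_inv, Cmod_mult by (apply Cmult_neq_0; auto). fold m.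
  apply Rmult_lt_reg_r with (Cmod (f u) * m); [apply Rmult_lt_0_compat; lra|].
  rewrite Rmult_assoc, Rinv_l, Rmult_1_r.
  2:{ apply Rmult_integral_contrapositive; split; lra. }
  eapply Rlt_trans; [apply A2|].
  apply Rle_lt_trans with (eps * m * (m/2)); [lra|].
  replace (eps * (Cmod (f u) * m)) with (eps * m * Cmod (f u)) by ring.
  apply Rmult_lt_compat_l; auto. apply Rmult_lt_0_compat; lra.
Qed.

Lemma cdiff_ccont (f : C -> C) (z : C) : cdiff f z -> ccont f z.
Proof.
  intros [phi [Hp [del [Hd H]]]].
  apply ccont_ext_loc with (fun u => f z + phi u * (u - z))%C del; auto.
  - intros; symmetry; auto.
  - apply ccont_plus; [apply ccont_const|]. apply ccont_mult; auto.
    apply ccont_plus; [apply ccont_id|apply ccont_const].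
Qed.

Lemma cdiff_const (c z : C) : cdiff (fun _ => c) z.
Proof.
  exists (fun _ => RtoC 0); split; [apply ccont_const|]. exists 1; split; [lra|]; intros; ring.
Qed.

Lemma cdiff_id (z : C) : cdiff (fun u => u) z.
Proof.
  exists (fun _ => RtoC 1); split; [apply ccont_const|]. exists 1; split; [lra|]; intros; ring.
Qed.

Lemma cdiff_plus (f g : C -> C) (z : C) :
  cdiff f z -> cdiff g z -> cdiff (fun u => f u + g u)%C z.
Proof.
  intros [p [Hp [d1 [Hd1 H1]]]] [q [Hq [d2 [Hd2 H2]]]].
  exists (fun u => p u + q u)%C; split; [apply ccont_plus; auto|].
  exists (Rmin d1 d2); split; [apply Rmin_glb_lt; lra|]. intros u Hu.
  rewrite H1, H2; [ring| |]; eapply Rlt_le_trans; try apply Hu; [apply Rmin_r|apply Rmin_l].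
Qed.

Lemma cdiff_mult (f g : C -> C) (z : C) :
  cdiff f z -> cdiff g z -> cdiff (fun u => f u * g u)%C z.
Proof.
  intros Hf Hg. assert (Cg := cdiff_ccont _ _ Hg). revert Hf Hg.
  intros [p [Hp [d1 [Hd1 H1]]]] [q [Hq [d2 [Hd2 H2]]]].
  exists (fun u => p u * g u + f z * q u)%C; split.
  { apply ccont_plus; apply ccont_mult; auto; apply ccont_const. }
  exists (Rmin d1 d2); split; [apply Rmin_glb_lt; lra|]. intros u Hu.
  rewrite H1; [|eapply Rlt_le_trans; [apply Hu|apply Rmin_l]].
  rewrite (H2 u) by (eapply Rlt_le_trans; [apply Hu|apply Rmin_r]). ring.
Qed.

Lemma cdiff_comp (f g : C -> C) (z : C) :
  cdiff g z -> cdiff f (g z) -> cdiff (fun u => f (g u)) z.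
Proof.
  intros Hg [p [Hp [d1 [Hd1 H1]]]]. assert (Cg := cdiff_ccont _ _ Hg).
  destruct Hg as [q [Hq [d2 [Hd2 H2]]]].
  exists (fun u => p (g u) * q u)%C; split.
  { apply ccont_mult; auto. apply ccont_comp with (f := p); auto. }
  destruct (Cg d1 Hd1) as [d3 [Hd3 H3]].
  exists (Rmin d3 d2); split; [apply Rmin_glb_lt; lra|]. intros u Hu.
  rewrite H1; [|apply H3; eapply Rlt_le_trans; [apply Hu|apply Rmin_l]].
  replace (g u - g z)%C with (q u * (u - z))%C; [ring|].
  rewrite (H2 u) by (eapply Rlt_le_trans; [apply Hu|apply Rmin_r]). ring.
Qed.

Lemma cdiff_inv (f : C -> C) (z : C) :
  f z <> 0 -> cdiff f z -> cdiff (fun u => / f u)%C z.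
Proof.
  intros Hz Hf. assert (Cf := cdiff_ccont _ _ Hf).
  assert (Pm : 0 < Cmod (f z)) by (apply Cmod_gt_0; auto).
  destruct Hf as [p [Hp [d1 [Hd1 H1]]]].
  destruct (Cf _ Pm) as [d2 [Hd2 H2]].
  exists (fun u => - (1) * p u * / f u * / f z)%C; split.
  { repeat apply ccont_mult; auto; try apply ccont_const. apply ccont_inv; auto. }
  exists (Rmin d1 d2); split; [apply Rmin_glb_lt; lra|]. intros u Hu.
  assert (Nu : f u <> 0).
  { intro E. specialize (H2 u ltac:(eapply Rlt_le_trans; [apply Hu|apply Rmin_r])).
    rewrite E in H2. replace (0 - f z)%C with (- f z)%C in H2 by ring.
    rewrite Cmod_opp in H2. lra. }
  replace (- (1) * p u * / f u * / f z * (u - z))%C with (- (p u * (u - z)) * / (f u * f z))%C by (field; auto).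
  replace (p u * (u - z))%C with (f u - f z)%C.
  2:{ rewrite H1 by (eapply Rlt_le_trans; [apply Hu|apply Rmin_l]). ring. }
  field; auto.
Qed.

Lemma cdiff_of_ex_derive (f : C -> C) (z : C) : C_differentiable f z -> cdiff f z.
Proof.
  (* Domination is stated at every limit point of the filter; at [z] itself it is the little-o
     estimate for the difference quotient. *)
  intros [l [_ H]]. specialize (H z (fun P HP => HP)).
  exists (fun u => if Ceq_dec u z then l else (f u - f z) / (u - z))%C.
  split.
  2:{ exists 1; split; [lra|]. intros u _. destruct (Ceq_dec u z) as [->|N]; [ring|].
      field. intro E. apply N. replace u with (u - z + z)%C by ring. rewrite E; ring. }
  intros eps He.
  assert (He2 : 0 < eps / 2) by lra.
  specialize (H (mkposreal _ He2)). destruct H as [del Hdel].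
  exists del. split; [apply cond_pos|]. intros u Hu.
  destruct (Ceq_dec z z) as [_|N]; [|congruence].
  destruct (Ceq_dec u z) as [->|N].
  { replace (l - l)%C with (RtoC 0) by ring. rewrite Cmod_0; lra. }
  assert (Nz : (u - z)%C <> 0).
  { intro E. apply N. replace u with (u - z + z)%C by ring. rewrite E; ring. }
  assert (Pz : 0 < Cmod (u - z)) by (apply Cmod_gt_0; auto).
  specialize (Hdel u Hu).
  change (Cmod (f u - f z - (u - z) * l) <= eps / 2 * Cmod (u - z)) in Hdel.
  replace ((f u - f z) / (u - z) - l)%C with ((f u - f z - (u - z) * l) / (u - z))%C by (field; auto).
  rewrite Cmod_div by auto.
  apply Rle_lt_trans with (eps / 2); [|lra].
  apply Rmult_le_reg_r with (Cmod (u - z)); auto.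
  unfold Rdiv at 1. rewrite Rmult_assoc, Rinv_l, Rmult_1_r; lra.
Qed.

(** * Contour integrals over rectangles *)

Definition rcont (f : R -> C) (x : R) : Prop :=
  continuous (fun t => Re (f t)) x /\ continuous (fun t => Im (f t)) x.

Lemma continuous_of_lt (g : R -> R) (x : R) :
  (forall eps, 0 < eps -> exists del, 0 < del /\
     forall t, Rabs (t - x) < del -> Rabs (g t - g x) < eps) -> continuous g x.
Proof.
  intros H. apply continuity_pt_filterlim. intros eps He.
  destruct (H eps He) as [d [Hd Hd2]]. exists d; split; auto.
  intros t [_ Ht]. apply Hd2. exact Ht.
Qed.

(** Horizontal and vertical sides are isometric paths, so one statement about 1-Lipschitz paths
    serves both. *)
Lemma rcont_comp (f : C -> C) (p : R -> C) (x : R) :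
  (forall t, Cmod (p t - p x) <= Rabs (t - x)) -> ccont f (p x) ->
  rcont (fun t => f (p t)) x.
Proof.
  intros Hp Hf. split; apply continuous_of_lt; intros eps He;
    destruct (Hf eps He) as [d [Hd H]]; exists d; split; auto; intros t Ht;
    (eapply Rle_lt_trans; [|apply (H (p t)); eapply Rle_lt_trans; [apply Hp|apply Ht]]).
  - apply (re_le_Cmod (f (p t) - f (p x))).
  - apply (Im_le_Cmod (f (p t) - f (p x))).
Qed.

Lemma rcont_h (f : C -> C) (x y : R) : ccont f (x, y) -> rcont (fun t => f (t, y)) x.
Proof.
  intros H. apply (rcont_comp f (fun t => (t, y))); auto.
  intros t. replace ((t, y) - (x, y))%C with (RtoC (t - x)) by cring. rewrite Cmod_R; lra.
Qed.

Lemma rcont_v (f : C -> C) (x y : R) : ccont f (x, y) -> rcont (fun t => f (x, t)) y.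
Proof.
  intros H. apply (rcont_comp f (fun t => (x, t))); auto.
  intros t. replace ((x, t) - (x, y))%C with (Ci * RtoC (t - y))%C by cring.
  rewrite Cmod_mult, Cmod_Ci, Cmod_R; lra.
Qed.

(* Componentwise, because Coquelicot's complete normed module on C has scalars C, while RInt needs scalars R. *)
Definition CI (f : R -> C) (a b : R) : C :=
  (RInt (fun t => Re (f t)) a b, RInt (fun t => Im (f t)) a b).

Definition CIex (f : R -> C) (a b : R) : Prop :=
  ex_RInt (fun t => Re (f t)) a b /\ ex_RInt (fun t => Im (f t)) a b.

Lemma CIex_cont (f : R -> C) (a b : R) :
  (forall x, Rmin a b <= x <= Rmax a b -> rcont f x) -> CIex f a b.
Proof.
  intros H; split; apply (ex_RInt_continuous (V := R_CompleteNormedModule));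
    intros z Hz; apply (H z Hz).
Qed.

(** Links the componentwise integral to the integral of C-valued functions, in which the norm
    inequality and the final improper integral are expressed. *)
Lemma CI_is (f : R -> C) (a b : R) : CIex f a b -> is_RInt f a b (CI f a b).
Proof.
  intros [H1 H2]. apply (is_RInt_fct_extend_pair (U := R_NormedModule) (V := R_NormedModule));
    [apply (RInt_correct (V := R_CompleteNormedModule) _ _ _ H1)
    |apply (RInt_correct (V := R_CompleteNormedModule) _ _ _ H2)].
Qed.

Lemma CI_unique (f : R -> C) (a b : R) (u v : R) :
  is_RInt (fun t => Re (f t)) a b u -> is_RInt (fun t => Im (f t)) a b v ->
  CIex f a b /\ CI f a b = (u, v).
Proof.
  intros H1 H2. split; [split; eexists; eauto|].
  unfold CI. f_equal; apply is_RInt_unique; auto.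
Qed.

Lemma CI_lin (f g : R -> C) (a b : R) (c k : C) :
  CIex f a b -> CIex g a b ->
  CIex (fun t => c * f t + k * g t)%C a b /\
  CI (fun t => c * f t + k * g t)%C a b = (c * CI f a b + k * CI g a b)%C.
Proof.
  intros [F1 F2] [G1 G2].
  apply (RInt_correct (V := R_CompleteNormedModule)) in F1.
  apply (RInt_correct (V := R_CompleteNormedModule)) in F2.
  apply (RInt_correct (V := R_CompleteNormedModule)) in G1.
  apply (RInt_correct (V := R_CompleteNormedModule)) in G2.
  destruct c as [c1 c2], k as [k1 k2]. apply CI_unique.
  - apply (is_RInt_ext (V := R_NormedModule)
      (fun t => plus (minus (scal c1 (Re (f t))) (scal c2 (Im (f t))))
                     (minus (scal k1 (Re (g t))) (scal k2 (Im (g t)))))).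
    { intros x _. unfold plus, minus, opp, scal; simpl. unfold mult, plus, Re, Im; simpl. ring. }
    unfold CI, Re, Im; simpl.
    apply (is_RInt_plus (V := R_NormedModule)); apply (is_RInt_minus (V := R_NormedModule));
    apply (is_RInt_scal (V := R_NormedModule)); auto.
  - apply (is_RInt_ext (V := R_NormedModule)
      (fun t => plus (plus (scal c1 (Im (f t))) (scal c2 (Re (f t))))
                     (plus (scal k1 (Im (g t))) (scal k2 (Re (g t)))))).
    { intros x _. unfold plus, minus, opp, scal; simpl. unfold mult, plus, Re, Im; simpl. ring. }
    unfold CI, Re, Im; simpl.
    apply (is_RInt_plus (V := R_NormedModule)); apply (is_RInt_plus (V := R_NormedModule));
    apply (is_RInt_scal (V := R_NormedModule)); auto.
Qed.

Lemma CI_ext (f g : R -> C) (a b : R) :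
  (forall x, Rmin a b <= x <= Rmax a b -> f x = g x) -> CI f a b = CI g a b.
Proof.
  intros H; unfold CI; f_equal; apply RInt_ext; intros x Hx; rewrite H; auto; lra.
Qed.

Lemma CI_minus (f g : R -> C) (a b : R) : CIex f a b -> CIex g a b ->
  CI (fun t => f t - g t)%C a b = (CI f a b - CI g a b)%C.
Proof.
  intros Hf Hg. destruct (CI_lin f g a b 1 (-(1)) Hf Hg) as [_ H].
  replace (CI f a b - CI g a b)%C with (1 * CI f a b + -(1) * CI g a b)%C by ring.
  rewrite <- H. apply CI_ext; intros; ring.
Qed.

Lemma CI_Chasles (f : R -> C) (a b c : R) : CIex f a b -> CIex f b c ->
  (CI f a b + CI f b c = CI f a c)%C.
Proof.
  intros [H1 H2] [H3 H4]. unfold CI, Cplus; simpl. f_equal.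
  - apply (RInt_Chasles (V := R_CompleteNormedModule) (fun t => Re (f t))); auto.
  - apply (RInt_Chasles (V := R_CompleteNormedModule) (fun t => Im (f t))); auto.
Qed.

(** Bounding the two components separately would cost a constant factor. The modulus is instead
    recognised as the norm of the product module, for which the integral inequality holds as it
    stands. *)
Lemma CI_norm (f : R -> C) (g : R -> R) (a b : R) : a <= b ->
  (forall x, a <= x <= b -> Cmod (f x) <= g x) -> CIex f a b -> ex_RInt g a b ->
  Cmod (CI f a b) <= RInt g a b.
Proof.
  intros Hab H Hf Hg. apply CI_is in Hf.
  assert (N : forall z : C, Cmod z = @norm _ (prod_NormedModule R_AbsRing R_NormedModule R_NormedModule) z).
  { intros z. unfold Cmod, norm; simpl. unfold prod_norm, norm; simpl. unfold abs; simpl.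
    f_equal. rewrite !Rmult_1_r, <- !Rabs_mult, !Rabs_pos_eq by nra. ring. }
  rewrite N. eapply norm_RInt_le; [exact Hab| |exact Hf|apply (RInt_correct (V := R_CompleteNormedModule)), Hg].
  intros x Hx. rewrite <- N. auto.
Qed.

Lemma CI_norm_const (f : R -> C) (B : R) (a b : R) : a <= b ->
  (forall x, a <= x <= b -> Cmod (f x) <= B) -> CIex f a b ->
  Cmod (CI f a b) <= (b - a) * B.
Proof.
  intros Hab H Hf.
  replace ((b - a) * B) with (RInt (fun _ => B) a b).
  - apply CI_norm; auto. apply (ex_RInt_const (V := R_NormedModule)).
  - rewrite RInt_const. reflexivity.
Qed.

Lemma CI_affine (p q : C) (a b : R) :
  CI (fun t => p * RtoC t + q)%C a b = (p * RtoC ((b * b - a * a) / 2) + q * RtoC (b - a))%C.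
Proof.
  assert (HI : is_RInt (fun t : R => t) a b ((b * b - a * a) / 2)).
  { replace ((b*b-a*a)/2) with (minus (b*b/2) (a*a/2)) by (unfold minus, plus, opp; simpl; field).
    apply (is_RInt_derive (fun t => t * t / 2) (fun t => t)).
    - intros x _. auto_derive; auto. field.
    - intros x _. apply continuous_id. }
  destruct (CI_unique (fun t => RtoC t) a b ((b * b - a * a) / 2) 0) as [E1 V1]; [exact HI| |].
  { apply (is_RInt_ext (V := R_NormedModule) (fun _ => 0)); [reflexivity|].
    assert (H0 := is_RInt_const (V := R_NormedModule) a b 0).
    replace (scal (b - a) (0 : R_NormedModule)) with 0 in H0 by (unfold scal; simpl; unfold mult; simpl; ring).
    exact H0. }
  destruct (CI_unique (fun t => RtoC 1) a b (b - a) 0) as [E2 V2].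
  { assert (H0 := is_RInt_const (V := R_NormedModule) a b 1).
    replace (scal (b - a) (1 : R_NormedModule)) with (b - a) in H0 by (unfold scal; simpl; unfold mult; simpl; ring).
    exact H0. }
  { assert (H0 := is_RInt_const (V := R_NormedModule) a b 0).
    replace (scal (b - a) (0 : R_NormedModule)) with 0 in H0 by (unfold scal; simpl; unfold mult; simpl; ring).
    exact H0. }
  destruct (CI_lin _ _ a b p q E1 E2) as [_ H].
  rewrite V1, V2 in H. rewrite (CI_ext _ (fun t => p * RtoC t + q * 1)%C) by (intros; ring).
  exact H.
Qed.

(* Counterclockwise contour integral over the boundary of [a, b] x [c, e]. *)
Definition rectI (f : C -> C) (a b c e : R) : C :=
  (CI (fun x => f (x, c)) a b - CI (fun x => f (x, e)) a b
   + Ci * (CI (fun y => f (b, y)) c e - CI (fun y => f (a, y)) c e))%C.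

Lemma CIex_h (f : C -> C) (a b y : R) : a <= b ->
  (forall x, a <= x <= b -> ccont f (x, y)) -> CIex (fun x => f (x, y)) a b.
Proof.
  intros Hab H. apply CIex_cont. rewrite Rmin_left, Rmax_right by auto.
  intros x Hx. apply rcont_h; auto.
Qed.

Lemma CIex_v (f : C -> C) (x c e : R) : c <= e ->
  (forall y, c <= y <= e -> ccont f (x, y)) -> CIex (fun y => f (x, y)) c e.
Proof.
  intros Hab H. apply CIex_cont. rewrite Rmin_left, Rmax_right by auto.
  intros y Hy. apply rcont_v; auto.
Qed.

(** Continuity and bounds are asked for on the boundary alone, because the lemmas below are also
    applied to integrands with a pole inside the rectangle. *)
Definition edge (a b c e x y : R) : Prop :=
  a <= x <= b /\ c <= y <= e /\ (x = a \/ x = b \/ y = c \/ y = e).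

Lemma rectI_split_x (f : C -> C) (a m b c e : R) : a <= m <= b ->
  (forall x, a <= x <= b -> ccont f (x, c) /\ ccont f (x, e)) ->
  rectI f a b c e = (rectI f a m c e + rectI f m b c e)%C.
Proof.
  intros Hm H. unfold rectI.
  rewrite <- (CI_Chasles (fun x => f (x, c)) a m b), <- (CI_Chasles (fun x => f (x, e)) a m b);
    try (apply CIex_h; [lra|]; intros x Hx; apply H; lra).
  ring.
Qed.

Lemma rectI_split_y (f : C -> C) (a b c m e : R) : c <= m <= e ->
  (forall y, c <= y <= e -> ccont f (a, y) /\ ccont f (b, y)) ->
  rectI f a b c e = (rectI f a b c m + rectI f a b m e)%C.
Proof.
  intros Hm H. unfold rectI.
  rewrite <- (CI_Chasles (fun y => f (a, y)) c m e), <- (CI_Chasles (fun y => f (b, y)) c m e);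
    try (apply CIex_v; [lra|]; intros x Hx; apply H; lra).
  ring.
Qed.

Lemma rectI_lin (f g : C -> C) (p q : C) (a b c e : R) : a <= b -> c <= e ->
  (forall x y, edge a b c e x y -> ccont f (x, y)) ->
  (forall x y, edge a b c e x y -> ccont g (x, y)) ->
  rectI (fun z => p * f z + q * g z)%C a b c e
  = (p * rectI f a b c e + q * rectI g a b c e)%C.
Proof.
  intros Hab Hce Hf Hg. unfold rectI.
  assert (Fh : forall u, u = c \/ u = e -> CIex (fun x => f (x, u)) a b).
  { intros; apply CIex_h; auto. intros; apply Hf; unfold edge; repeat split; lra. }
  assert (Gh : forall u, u = c \/ u = e -> CIex (fun x => g (x, u)) a b).
  { intros; apply CIex_h; auto. intros; apply Hg; unfold edge; repeat split; lra. }
  assert (Fv : forall u, u = a \/ u = b -> CIex (fun y => f (u, y)) c e).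
  { intros; apply CIex_v; auto. intros; apply Hf; unfold edge; repeat split; lra. }
  assert (Gv : forall u, u = a \/ u = b -> CIex (fun y => g (u, y)) c e).
  { intros; apply CIex_v; auto. intros; apply Hg; unfold edge; repeat split; lra. }
  rewrite (proj2 (CI_lin (fun x => f (x, c)) (fun x => g (x, c)) a b p q (Fh c (or_introl eq_refl)) (Gh c (or_introl eq_refl)))).
  rewrite (proj2 (CI_lin (fun x => f (x, e)) (fun x => g (x, e)) a b p q (Fh e (or_intror eq_refl)) (Gh e (or_intror eq_refl)))).
  rewrite (proj2 (CI_lin (fun y => f (a, y)) (fun y => g (a, y)) c e p q (Fv a (or_introl eq_refl)) (Gv a (or_introl eq_refl)))).
  rewrite (proj2 (CI_lin (fun y => f (b, y)) (fun y => g (b, y)) c e p q (Fv b (or_intror eq_refl)) (Gv b (or_intror eq_refl)))).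
  ring.
Qed.

Lemma rectI_bound (f : C -> C) (B a b c e : R) : a <= b -> c <= e ->
  (forall x y, edge a b c e x y -> ccont f (x, y)) ->
  (forall x y, edge a b c e x y -> Cmod (f (x, y)) <= B) ->
  Cmod (rectI f a b c e) <= 2 * B * ((b - a) + (e - c)).
Proof.
  intros Hab Hce Hf HB. unfold rectI.
  assert (Fh : forall u, u = c \/ u = e -> Cmod (CI (fun x => f (x, u)) a b) <= (b - a) * B).
  { intros. apply CI_norm_const; auto.
    - intros; apply HB; unfold edge; repeat split; lra.
    - apply CIex_h; auto. intros; apply Hf; unfold edge; repeat split; lra. }
  assert (Fv : forall u, u = a \/ u = b -> Cmod (CI (fun y => f (u, y)) c e) <= (e - c) * B).
  { intros. apply CI_norm_const; auto.
    - intros; apply HB; unfold edge; repeat split; lra.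
    - apply CIex_v; auto. intros; apply Hf; unfold edge; repeat split; lra. }
  eapply Rle_trans; [apply Cmod_triangle|].
  rewrite Cmod_mult, Cmod_Ci.
  assert (T1 := Cmod_sum_le (CI (fun x => f (x, c)) a b) (CI (fun x => f (x, e)) a b)).
  assert (T2 := Cmod_sum_le (CI (fun y => f (b, y)) c e) (CI (fun y => f (a, y)) c e)).
  assert (A1 := Fh c (or_introl eq_refl)). assert (A2 := Fh e (or_intror eq_refl)).
  assert (A3 := Fv a (or_introl eq_refl)). assert (A4 := Fv b (or_intror eq_refl)).
  lra.
Qed.

(** Goursat's local estimate subtracts the first-order expansion of the function, which is of this
    form. Integrating the four sides explicitly takes the place of a primitive. *)
Lemma rectI_affine (p q : C) (a b c e : R) :
  rectI (fun z => p * z + q)%C a b c e = 0.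
Proof.
  unfold rectI.
  assert (H : forall y, CI (fun x => p * (x, y) + q)%C a b
     = (p * RtoC ((b * b - a * a) / 2) + (q + p * (Ci * RtoC y)) * RtoC (b - a))%C).
  { intros y. rewrite <- CI_affine. apply CI_ext; intros x _. cring. }
  assert (V : forall x, CI (fun y => p * (x, y) + q)%C c e
     = ((p * Ci) * RtoC ((e * e - c * c) / 2) + (q + p * RtoC x) * RtoC (e - c))%C).
  { intros x. rewrite <- CI_affine. apply CI_ext; intros y _. cring. }
  rewrite !H, !V. destruct p, q. cring.
Qed.

(** * Goursat's theorem by bisection *)

Lemma nested_intervals (u v : nat -> R) :
  (forall k, u k <= u (S k)) -> (forall k, v (S k) <= v k) -> (forall k, u k <= v k) ->
  exists x, forall k, u k <= x <= v k.
Proof.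
  intros Hu Hv Huv.
  assert (Mu : forall m k, u m <= u (m + k)%nat).
  { intros m; induction k; [rewrite Nat.add_0_r; lra|rewrite Nat.add_succ_r].
    eapply Rle_trans; [apply IHk|apply Hu]. }
  assert (Mv : forall m k, v (m + k)%nat <= v m).
  { intros m; induction k; [rewrite Nat.add_0_r; lra|rewrite Nat.add_succ_r].
    eapply Rle_trans; [apply Hv|apply IHk]. }
  assert (Huv2 : forall m n, u m <= v n).
  { intros m n. apply Rle_trans with (u (m + n)%nat); [apply Mu|].
    apply Rle_trans with (v (m + n)%nat); [apply Huv|]. rewrite Nat.add_comm. apply Mv. }
  destruct (completeness (fun t => exists k, t = u k)) as [x [X1 X2]].
  - exists (v O). intros t [k ->]. apply Huv2.
  - exists (u O), O; auto.
  - exists x. intros k; split.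
    + apply X1. exists k; auto.
    + apply X2. intros t [m ->]. apply Huv2.
Qed.

Section Goursat.

Variables (f : C -> C) (a b c e : R).
Hypothesis Hab : a <= b.
Hypothesis Hce : c <= e.
Hypothesis Hf : forall x y, a <= x <= b -> c <= y <= e -> cdiff f (x, y).

Let size (k : nat) (s : R) := s / 2 ^ k.

(** All cells of one generation have the same size, so the bisection only has to follow the lower
    left corner. *)
Let cellI (k : nat) (p : R * R) : C :=
  rectI f (fst p) (fst p + size k (b - a)) (snd p) (snd p + size k (e - c)).

Let inside (k : nat) (p : R * R) : Prop :=
  a <= fst p /\ fst p + size k (b - a) <= b /\ c <= snd p /\ snd p + size k (e - c) <= e.

Let size_pos k s : 0 <= s -> 0 <= size k s.
Proof.
  intros. unfold size. apply Rmult_le_pos; auto.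
  left; apply Rinv_0_lt_compat, pow_lt; lra.
Qed.

Let size_S k s : size (S k) s = size k s / 2.
Proof. unfold size; simpl. field. apply pow_nonzero; lra. Qed.

(** Selects a quarter that keeps at least a fourth of the modulus of the integral. The last quarter
    is the default: the four integrals add up to that of the parent, so it must pass the test when
    the other three fail. *)
Let child (k : nat) (p : R * R) : R * R :=
  let x := fst p in let y := snd p in
  let x' := x + size (S k) (b - a) in let y' := y + size (S k) (e - c) in
  let big q := Rle_dec (Cmod (cellI k p) / 4) (Cmod (cellI (S k) q)) in
  if big (x, y) then (x, y) else if big (x', y) then (x', y)
  else if big (x, y') then (x, y') else (x', y').

Let child_spec k p : inside k p ->
  Cmod (cellI k p) / 4 <= Cmod (cellI (S k) (child k p)) /\
  (fst (child k p) = fst p \/ fst (child k p) = fst p + size (S k) (b - a)) /\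
  (snd (child k p) = snd p \/ snd (child k p) = snd p + size (S k) (e - c)).
Proof.
  intros [I1 [I2 [I3 I4]]]. unfold child; cbv zeta.
  destruct p as [x y]; simpl fst in *; simpl snd in *.
  set (X := size (S k) (b - a)). set (Y := size (S k) (e - c)).
  destruct (Rle_dec _ _) as [L1|L1]; [simpl; auto|].
  destruct (Rle_dec _ _) as [L2|L2]; [simpl; auto|].
  destruct (Rle_dec _ _) as [L3|L3]; [simpl; auto|].
  split; [|simpl; auto].
  assert (EX : size k (b - a) = X + X) by (unfold X; rewrite size_S; lra).
  assert (EY : size k (e - c) = Y + Y) by (unfold Y; rewrite size_S; lra).
  assert (PX : 0 <= X) by (apply size_pos; lra).
  assert (PY : 0 <= Y) by (apply size_pos; lra).
  rewrite EX in I2. rewrite EY in I4.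
  assert (CC : forall u v, x <= u <= x + (X + X) -> y <= v <= y + (Y + Y) -> ccont f (u, v)).
  { intros; apply cdiff_ccont, Hf; lra. }
  assert (E : cellI k (x, y) =
    (cellI (S k) (x, y) + cellI (S k) ((x + X)%R, y) + cellI (S k) (x, (y + Y)%R) + cellI (S k) ((x + X)%R, (y + Y)%R))%C).
  { unfold cellI; simpl fst; simpl snd. fold X Y. rewrite EX, EY.
    rewrite (rectI_split_x f x (x + X) (x + (X + X))) by (first [lra | intros; split; apply CC; lra]).
    rewrite (rectI_split_y f x (x + X) y (y + Y)) by (first [lra | intros; split; apply CC; lra]).
    rewrite (rectI_split_y f (x + X) (x + (X + X)) y (y + Y)) by (first [lra | intros; split; apply CC; lra]).
    rewrite !Rplus_assoc. ring. }
  assert (T := f_equal Cmod E).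
  assert (T1 := Cmod_triangle (cellI (S k) (x, y) + cellI (S k) (x + X, y) + cellI (S k) (x, y + Y)) (cellI (S k) (x + X, y + Y))).
  assert (T2 := Cmod_triangle (cellI (S k) (x, y) + cellI (S k) (x + X, y)) (cellI (S k) (x, y + Y))).
  assert (T3 := Cmod_triangle (cellI (S k) (x, y)) (cellI (S k) (x + X, y))).
  lra.
Qed.

Let corner : nat -> R * R :=
  fix corner k := match k with O => (a, c) | S k => child k (corner k) end.

Let corner_inside k : inside k (corner k).
Proof.
  induction k as [|k IH].
  - unfold inside, size; simpl. split; [lra|]. split; [lra|]. split; lra.
  - simpl. destruct (child_spec k _ IH) as [_ [S1 S2]].
    destruct IH as [I1 [I2 [I3 I4]]]. unfold inside.
    assert (P1 : 0 <= size (S k) (b - a)) by (apply size_pos; lra).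
    assert (P2 : 0 <= size (S k) (e - c)) by (apply size_pos; lra).
    assert (E1 := size_S k (b - a)). assert (E2 := size_S k (e - c)).
    destruct S1, S2; repeat split; lra.
Qed.

Let corner_large k : Cmod (cellI 0 (a, c)) / 4 ^ k <= Cmod (cellI k (corner k)).
Proof.
  induction k as [|k IH]; [simpl; lra|].
  simpl corner. destruct (child_spec k _ (corner_inside k)) as [H _].
  eapply Rle_trans; [|apply H].
  replace (Cmod (cellI 0 (a, c)) / 4 ^ S k) with (Cmod (cellI 0 (a, c)) / 4 ^ k / 4);
    [lra|]. simpl; field. apply pow_nonzero; lra.
Qed.

Theorem goursat : rectI f a b c e = 0.
Proof.
  apply NNPP; intros N.
  assert (E0 : cellI 0 (a, c) = rectI f a b c e).
  { unfold cellI, size; simpl. f_equal; lra. }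
  apply Cmod_gt_0 in N. rewrite <- E0 in N.
  set (eps0 := Cmod (cellI 0 (a, c))) in *.
  assert (ST : forall k, (fst (corner k) <= fst (corner (S k)) /\
      fst (corner (S k)) + size (S k) (b - a) <= fst (corner k) + size k (b - a)) /\
     (snd (corner k) <= snd (corner (S k)) /\
      snd (corner (S k)) + size (S k) (e - c) <= snd (corner k) + size k (e - c))).
  { intros k. simpl corner. destruct (child_spec k _ (corner_inside k)) as [_ [S1 S2]].
    assert (P1 : 0 <= size (S k) (b - a)) by (apply size_pos; lra).
    assert (P2 : 0 <= size (S k) (e - c)) by (apply size_pos; lra).
    assert (E1 := size_S k (b - a)). assert (E2 := size_S k (e - c)).
    destruct S1, S2; repeat split; lra. }
  destruct (nested_intervals (fun k => fst (corner k)) (fun k => fst (corner k) + size k (b - a)))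
    as [X HX]; try (intros k; apply ST).
  { intros k. assert (0 <= size k (b - a)) by (apply size_pos; lra). lra. }
  destruct (nested_intervals (fun k => snd (corner k)) (fun k => snd (corner k) + size k (e - c)))
    as [Y HY]; try (intros k; apply ST).
  { intros k. assert (0 <= size k (e - c)) by (apply size_pos; lra). lra. }
  assert (RX : a <= X <= b).
  { specialize (HX O). destruct (corner_inside 0) as [I1 [I2 _]]. lra. }
  assert (RY : c <= Y <= e).
  { specialize (HY O). destruct (corner_inside 0) as [_ [_ [I1 I2]]]. lra. }
  destruct (Hf X Y RX RY) as [phi [Hphi [d1 [Hd1 H1]]]].
  (* Half the perimeter, enlarged by 1 so that it is nonzero even for a degenerate rectangle. *)
  set (D := (b - a) + (e - c) + 1).
  assert (PD : 1 <= D) by (unfold D; lra).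
  (* With this tolerance the estimate on a cell of generation [k] becomes [eps0 / 4 ^ k / 2], half
     of the lower bound given by [corner_large]. *)
  assert (Peps : 0 < eps0 / (4 * D * D)).
  { apply Rdiv_lt_0_compat; auto. nra. }
  destruct (Hphi _ Peps) as [d2 [Hd2 H2]].
  assert (Hk : exists k, D / 2 ^ k < Rmin d1 d2).
  { assert (Pm : 0 < Rmin d1 d2 / D) by (apply Rdiv_lt_0_compat; [apply Rmin_glb_lt; lra|lra]).
    destruct (pow_lt_1_zero (/2) ltac:(rewrite Rabs_pos_eq; lra) _ Pm) as [k Hk].
    exists k. specialize (Hk k (Nat.le_refl k)).
    rewrite Rabs_pos_eq in Hk by (apply pow_le; lra).
    rewrite pow_inv in Hk. apply Rmult_lt_compat_l with (r := D) in Hk; [|lra].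
    replace (D * (Rmin d1 d2 / D)) with (Rmin d1 d2) in Hk by (field; lra). exact Hk. }
  destruct Hk as [k Hk].
  set (W := size k (b - a)). set (L := size k (e - c)).
  assert (PW : 0 <= W) by (apply size_pos; lra).
  assert (PL : 0 <= L) by (apply size_pos; lra).
  assert (P2k : 0 < 2 ^ k) by (apply pow_lt; lra).
  assert (WL : W + L <= D / 2 ^ k).
  { unfold W, L, size. replace ((b - a) / 2 ^ k + (e - c) / 2 ^ k) with (((b - a) + (e - c)) / 2 ^ k) by (field; lra).
    unfold Rdiv. apply Rmult_le_compat_r; [left; apply Rinv_0_lt_compat; auto|unfold D; lra]. }
  specialize (HX k); specialize (HY k). cbv beta in HX, HY. fold W in HX. fold L in HY.
  set (x0 := fst (corner k)) in *. set (y0 := snd (corner k)) in *.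
  set (Z := (X, Y) : C) in *.
  (* The remainder of the first-order expansion at [Z]. It has the same contour integral as [f], but
     is of size o(|u - Z|). *)
  set (err := fun u : C => (1 * f u + -(1) * (phi Z * u + (f Z - phi Z * Z)))%C).
  destruct (corner_inside k) as [I1 [I2 [I3 I4]]]. fold x0 y0 W L in I1, I2, I3, I4.
  assert (Cf : forall x y, edge x0 (x0 + W) y0 (y0 + L) x y -> ccont f (x, y)).
  { intros x y [A1 [A2 _]]. apply cdiff_ccont, Hf; lra. }
  assert (Ca : forall z, ccont (fun u => phi Z * u + (f Z - phi Z * Z))%C z).
  { intros z. apply ccont_plus; [|apply ccont_const]. apply ccont_mult; [apply ccont_const|apply ccont_id]. }
  assert (ER : rectI err x0 (x0 + W) y0 (y0 + L) = cellI k (corner k)).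
  { unfold err. rewrite rectI_lin; auto; try lra. rewrite rectI_affine. unfold cellI.
    fold x0 y0 W L. ring. }
  assert (BD : Cmod (rectI err x0 (x0 + W) y0 (y0 + L))
     <= 2 * (eps0 / (4 * D * D) * (D / 2 ^ k)) * ((x0 + W - x0) + (y0 + L - y0))).
  { apply rectI_bound; try lra.
    - intros x y Hxy. unfold err. apply ccont_plus; apply ccont_mult; auto; apply ccont_const.
    - intros x y [A1 [A2 _]].
      assert (ZB : Cmod ((x, y) - Z) <= W + L).
      { unfold Z. replace ((x, y) - (X, Y))%C with ((x - X, y - Y) : C) by cring.
        eapply Rle_trans; [apply Cmod_pair_le|].
        apply Rplus_le_compat; apply Rabs_le; lra. }
      assert (M1 := Rmin_l d1 d2). assert (M2 := Rmin_r d1 d2).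
      unfold err. rewrite (H1 (x, y)) by lra.
      replace (1 * (f Z + phi (x, y) * ((x, y) - Z)) + - (1) * (phi Z * (x, y) + (f Z - phi Z * Z)))%C
        with ((phi (x, y) - phi Z) * ((x, y) - Z))%C by ring.
      rewrite Cmod_mult. apply Rmult_le_compat; try apply Cmod_ge_0; [|lra].
      left. apply H2. lra. }
  rewrite ER in BD. assert (LG := corner_large k). fold eps0 in LG.
  assert (F1 : 2 * (eps0 / (4 * D * D) * (D / 2 ^ k)) * ((x0 + W - x0) + (y0 + L - y0))
     <= 2 * (eps0 / (4 * D * D) * (D / 2 ^ k)) * (D / 2 ^ k)).
  { apply Rmult_le_compat_l; [|lra].
    assert (0 < D / 2 ^ k) by (apply Rdiv_lt_0_compat; lra). nra. }
  replace (2 * (eps0 / (4 * D * D) * (D / 2 ^ k)) * (D / 2 ^ k)) with (eps0 / 4 ^ k / 2) in F1.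
  2:{ replace 4 with (2 * 2) at 1 by ring. rewrite Rpow_mult_distr. field. split; lra. }
  assert (0 < eps0 / 4 ^ k) by (apply Rdiv_lt_0_compat; auto; apply pow_lt; lra).
  lra.
Qed.

End Goursat.

(** * The summation kernel *)

(** By Goursat the contour may be shrunk to a square of half-side [t0] around the singularity. There
    [f] is bounded and the perimeter is [8 * t0], so the integral is as small as desired. *)
Lemma goursat_punctured (f : C -> C) (c e B del : R) :
  0 < c -> 0 < e -> 0 < del ->
  (forall x y, -c <= x <= c -> -e <= y <= e -> (x <> 0 \/ y <> 0) -> cdiff f (x, y)) ->
  (forall u : C, u <> 0 -> Cmod u < del -> Cmod (f u) <= B) ->
  rectI f (-c) c (-e) e = 0.
Proof.
  intros Hc He Hd Hf HB. apply NNPP; intros N. apply Cmod_gt_0 in N.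
  set (r := Cmod (rectI f (- c) c (- e) e)) in *.
  (* The entry [del / 4] keeps the square inside the disc where [f] is bounded; the last one makes
     [8 * B * t0] smaller than [r]. The sign of [B] is unknown, hence [Rabs B + 1]. *)
  set (t0 := Rmin (Rmin c e) (Rmin (del / 4) (r / (16 * (Rabs B + 1))))).
  assert (AB := Rabs_pos B). assert (LB := Rle_abs B).
  assert (P0 : 0 < t0).
  { unfold t0. repeat apply Rmin_glb_lt; try lra. apply Rdiv_lt_0_compat; lra. }
  assert (T1 : t0 <= c) by (unfold t0; eapply Rle_trans; [apply Rmin_l|apply Rmin_l]).
  assert (T2 : t0 <= e) by (unfold t0; eapply Rle_trans; [apply Rmin_l|apply Rmin_r]).
  assert (T3 : t0 <= del / 4) by (unfold t0; eapply Rle_trans; [apply Rmin_r|apply Rmin_l]).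
  assert (T4 : t0 <= r / (16 * (Rabs B + 1))) by (unfold t0; eapply Rle_trans; [apply Rmin_r|apply Rmin_r]).
  clearbody t0.
  assert (CC : forall x y, -c <= x <= c -> -e <= y <= e -> (x <> 0 \/ y <> 0) -> ccont f (x, y)).
  { intros; apply cdiff_ccont; auto. }
  assert (E : rectI f (-c) c (-e) e = rectI f (-t0) t0 (-t0) t0).
  { rewrite (rectI_split_x f (-c) (-t0) c) by (first [lra | intros; split; apply CC; lra]).
    rewrite (rectI_split_x f (-t0) t0 c) by (first [lra | intros; split; apply CC; lra]).
    rewrite (rectI_split_y f (-t0) t0 (-e) (-t0) e) by (first [lra | intros; split; apply CC; lra]).
    rewrite (rectI_split_y f (-t0) t0 (-t0) t0 e) by (first [lra | intros; split; apply CC; lra]).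
    rewrite (goursat f (-c) (-t0)) by (first [lra | intros; apply Hf; lra]).
    rewrite (goursat f t0 c) by (first [lra | intros; apply Hf; lra]).
    rewrite (goursat f (-t0) t0 (-e)) by (first [lra | intros; apply Hf; lra]).
    rewrite (goursat f (-t0) t0 t0 e) by (first [lra | intros; apply Hf; lra]).
    ring. }
  assert (BD : Cmod (rectI f (-t0) t0 (-t0) t0) <= 2 * B * ((t0 - - t0) + (t0 - - t0))).
  { apply rectI_bound; try lra.
    - intros x y [A1 [A2 A3]]. apply CC; lra.
    - intros x y [A1 [A2 A3]]. apply HB.
      + intro K. injection K. intros. lra.
      + eapply Rle_lt_trans; [apply Cmod_pair_le|].
        assert (Rabs x <= t0) by (apply Rabs_le; lra).
        assert (Rabs y <= t0) by (apply Rabs_le; lra). lra. }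
  rewrite <- E in BD. fold r in BD.
  assert (T5 : t0 * (16 * (Rabs B + 1)) <= r).
  { apply Rmult_le_compat_r with (r := 16 * (Rabs B + 1)) in T4; [|lra].
    replace (r / (16 * (Rabs B + 1)) * (16 * (Rabs B + 1))) with r in T4 by (field; lra). exact T4. }
  nra.
Qed.

(** * The complex exponential *)

Definition cexp (z : C) : C := (exp (fst z) * cos (snd z), exp (fst z) * sin (snd z)).

Lemma cexp_plus (u v : C) : cexp (u + v) = (cexp u * cexp v)%C.
Proof.
  destruct u as [a b], v as [x y]. unfold cexp; simpl.
  rewrite exp_plus, cos_plus, sin_plus. cring.
Qed.

Lemma Cmod_cexp (z : C) : Cmod (cexp z) = exp (fst z).
Proof.
  unfold Cmod, cexp; simpl. rewrite <- (sqrt_Rsqr (exp (fst z))) at 5 by (left; apply exp_pos).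
  f_equal. assert (H := sin2_cos2 (snd z)). unfold Rsqr in *.
  transitivity (exp (fst z) * exp (fst z) * (sin (snd z) * sin (snd z) + cos (snd z) * cos (snd z))); [ring|].
  rewrite H; ring.
Qed.

Lemma derivable_pt_lim_at_0 (g : R -> R) (l eps : R) : derivable_pt_lim g 0 l -> 0 < eps ->
  exists del, 0 < del /\ forall t, Rabs t < del -> Rabs (g t - g 0 - l * t) <= eps * Rabs t.
Proof.
  intros H He. destruct (H eps He) as [d Hd]. exists d. split; [apply cond_pos|].
  intros t Ht. destruct (Req_dec t 0) as [->|N].
  - rewrite Rabs_R0. replace (g 0 - g 0 - l * 0) with 0 by ring. rewrite Rabs_R0. lra.
  - specialize (Hd t N Ht). rewrite Rplus_0_l in Hd.
    replace (g t - g 0 - l * t) with (((g t - g 0) / t - l) * t) by (field; auto).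
    rewrite Rabs_mult. apply Rmult_le_compat_r; [apply Rabs_pos|lra].
Qed.

(** This is differentiability of the exponential at 0, obtained from the real derivatives of exp,
    cos and sin. The functional equation carries it to every other point in [cdiff_cexp]. *)
Lemma cexp_near_0 (eps : R) : 0 < eps ->
  exists del, 0 < del /\ forall u : C, Cmod u < del -> Cmod (cexp u - 1 - u) <= eps * Cmod u.
Proof.
  intros He.
  (* The error splits into four terms, each at most eps / 8 times |u|: [eps / 24] allows for the
     bound 3 on [exp a], the radius [eps / 32] makes the product of [exp a - 1] and [sin b] small,
     and the tolerance 1 gives the crude bounds by [2 * Rabs a] and [2 * Rabs b]. *)
  destruct (derivable_pt_lim_at_0 exp (exp 0) (eps / 8) (derivable_pt_lim_exp 0)) as [d1 [P1 H1]]; [lra|].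
  destruct (derivable_pt_lim_at_0 cos (- sin 0) (eps / 24) (derivable_pt_lim_cos 0)) as [d2 [P2 H2]]; [lra|].
  destruct (derivable_pt_lim_at_0 sin (cos 0) (Rmin 1 (eps / 8)) (derivable_pt_lim_sin 0)) as [d3 [P3 H3]].
  { apply Rmin_glb_lt; lra. }
  destruct (derivable_pt_lim_at_0 exp (exp 0) 1 (derivable_pt_lim_exp 0)) as [d4 [P4 H4]]; [lra|].
  rewrite exp_0 in *. rewrite sin_0, cos_0 in *.
  exists (Rmin (Rmin (Rmin d1 d2) (Rmin d3 d4)) (Rmin 1 (eps / 32))).
  split. { repeat apply Rmin_glb_lt; lra. }
  intros [a b] Hu.
  apply Rmin_Rgt_l in Hu. destruct Hu as [Hu Hu2].
  apply Rmin_Rgt_l in Hu. destruct Hu as [Hu0 Hu1].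
  apply Rmin_Rgt_l in Hu0. apply Rmin_Rgt_l in Hu1. apply Rmin_Rgt_l in Hu2.
  set (m := Cmod (a, b)) in *.
  assert (Ha : Rabs a <= m) by apply (re_le_Cmod (a, b)).
  assert (Hb : Rabs b <= m) by apply (Im_le_Cmod (a, b)).
  assert (Pa := Rabs_pos a). assert (Pb := Rabs_pos b).
  specialize (H1 a ltac:(lra)). specialize (H2 b ltac:(lra)).
  specialize (H3 b ltac:(lra)). specialize (H4 a ltac:(lra)).
  replace (exp a - 1 - 1 * a) with (exp a - 1 - a) in * by ring.
  replace (cos b - 1 - - 0 * b) with (cos b - 1) in H2 by ring.
  replace (sin b - 0 - 1 * b) with (sin b - b) in H3 by ring.
  assert (H3a : Rabs (sin b - b) <= eps / 8 * Rabs b).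
  { eapply Rle_trans; [apply H3|]. apply Rmult_le_compat_r; auto. apply Rmin_r. }
  assert (H3b : Rabs (sin b) <= 2 * Rabs b).
  { replace (sin b) with (sin b - b + b) by ring. eapply Rle_trans; [apply Rabs_triang|].
    assert (Rabs (sin b - b) <= 1 * Rabs b).
    { eapply Rle_trans; [apply H3|]. apply Rmult_le_compat_r; auto. apply Rmin_l. } lra. }
  assert (H4b : Rabs (exp a - 1) <= 2 * Rabs a).
  { replace (exp a - 1) with (exp a - 1 - a + a) by ring. eapply Rle_trans; [apply Rabs_triang|]. lra. }
  assert (H4c : Rabs (exp a) <= 3).
  { replace (exp a) with (exp a - 1 + 1) by ring. eapply Rle_trans; [apply Rabs_triang|].
    rewrite (Rabs_pos_eq 1) by lra. lra. }
  replace (cexp (a, b) - 1 - (a, b))%C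
    with ((exp a * (cos b - 1) + (exp a - 1 - a), (exp a - 1) * sin b + (sin b - b)) : C)
    by (unfold cexp; cring).
  eapply Rle_trans; [apply Cmod_pair_le|].
  assert (R1 := Rabs_triang (exp a * (cos b - 1)) (exp a - 1 - a)).
  assert (R2 := Rabs_triang ((exp a - 1) * sin b) (sin b - b)).
  rewrite Rabs_mult in R1, R2.
  assert (Q1 : Rabs (exp a) * Rabs (cos b - 1) <= 3 * (eps / 24 * m)).
  { apply Rmult_le_compat; try apply Rabs_pos; auto. eapply Rle_trans; [apply H2|].
    apply Rmult_le_compat_l; lra. }
  assert (Q2 : Rabs (exp a - 1) * Rabs (sin b) <= (2 * (eps / 32)) * (2 * m)).
  { apply Rmult_le_compat; try apply Rabs_pos; lra. }
  assert (Q3 : eps / 8 * Rabs a <= eps / 8 * m) by (apply Rmult_le_compat_l; lra).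
  assert (Q4 : eps / 8 * Rabs b <= eps / 8 * m) by (apply Rmult_le_compat_l; lra).
  assert (Pm : 0 <= eps * m) by (apply Rmult_le_pos; [lra|apply Cmod_ge_0]).
  lra.
Qed.

Lemma cdiff_cexp (z : C) : cdiff cexp z.
Proof.
  exists (fun u => cexp z * (if Ceq_dec u z then 1 else (cexp (u - z) - 1) / (u - z)))%C.
  split.
  - apply ccont_mult; [apply ccont_const|]. intros eps He.
    destruct (cexp_near_0 (eps / 2)) as [d [Hd H]]; [lra|].
    exists d; split; auto. intros u Hu.
    destruct (Ceq_dec z z) as [_|K]; [|congruence].
    destruct (Ceq_dec u z) as [_|K].
    + replace (1 - 1)%C with (RtoC 0) by ring. rewrite Cmod_0; lra.
    + assert (Nz : (u - z)%C <> 0).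
      { intro E. apply K. replace u with (u - z + z)%C by ring. rewrite E; ring. }
      specialize (H (u - z)%C Hu).
      replace ((cexp (u - z) - 1) / (u - z) - 1)%C with ((cexp (u - z) - 1 - (u - z)) / (u - z))%C by (field; auto).
      rewrite Cmod_div by auto. apply Cmod_gt_0 in Nz.
      apply Rle_lt_trans with (eps / 2); [|lra].
      apply Rmult_le_reg_r with (Cmod (u - z)); auto.
      unfold Rdiv at 1. rewrite Rmult_assoc, Rinv_l, Rmult_1_r; lra.
  - exists 1; split; [lra|]. intros u _. destruct (Ceq_dec u z) as [->|K]; [ring|].
    assert (Nz : (u - z)%C <> 0).
    { intro E. apply K. replace u with (u - z + z)%C by ring. rewrite E; ring. }
    replace u with ((u - z) + z)%C at 1 by ring. rewrite cexp_plus. field; auto.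
Qed.

(** This is e^(-2 pi i z / h), of modulus e^(2 pi y / h): large above the real axis and small below.
    Hence [ker] is close to 0 high above the axis and close to 1 far below it. *)
Definition kerw (h : R) (z : C) : C := cexp (RtoC (2 * PI / h) * (- Ci * z))%C.
Definition ker (h : R) (z : C) : C := (/ (1 - kerw h z))%C.

Lemma kerw_pair (h x y : R) : kerw h (x, y) =
  (exp (2 * PI / h * y) * cos (2 * PI / h * x), - (exp (2 * PI / h * y) * sin (2 * PI / h * x))).
Proof.
  unfold kerw, cexp. simpl.
  replace (_ * _ - _ * _) with (2 * PI / h * y) by ring.
  replace (_ * _ + _ * _) with (- (2 * PI / h * x)) by ring.
  rewrite cos_neg, sin_neg. f_equal; ring.
Qed.

Lemma Cmod_kerw (h x y : R) : Cmod (kerw h (x, y)) = exp (2 * PI / h * y).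
Proof.
  unfold kerw. rewrite Cmod_cexp. f_equal. simpl. ring.
Qed.

Lemma cdiff_kerw (h : R) (z : C) : cdiff (kerw h) z.
Proof.
  unfold kerw. apply cdiff_comp; [|apply cdiff_cexp].
  repeat apply cdiff_mult; try apply cdiff_const. apply cdiff_id.
Qed.

Lemma cdiff_ker (h : R) (z : C) : (1 - kerw h z)%C <> 0 -> cdiff (ker h) z.
Proof.
  intros H. unfold ker. apply (cdiff_inv (fun u => 1 - kerw h u)%C); auto.
  apply cdiff_plus; [apply cdiff_const|].
  apply (cdiff_comp (fun u => - u)%C); [apply cdiff_kerw|].
  assert (Q := cdiff_mult (fun _ => - (1))%C (fun u => u) (kerw h z) (cdiff_const _ _) (cdiff_id _)).
  destruct Q as [p [Hp [d [Hd Q]]]]. exists p; split; auto. exists d; split; auto.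
  intros u Hu. specialize (Q u Hu). rewrite <- (Cmult_1_l u) at 1.
  replace (- (1 * u))%C with (-(1) * u)%C by ring. rewrite Q. ring.
Qed.

Lemma ker_bound_up (h x y : R) : 0 < h -> 0 < y ->
  (1 - kerw h (x, y))%C <> 0 /\
  Cmod (ker h (x, y)) <= / (exp (2 * PI / h * y) - 1).
Proof.
  intros Hh Hy. assert (Pp := PI_RGT_0).
  assert (Pw : 0 < 2 * PI / h * y) by (apply Rmult_lt_0_compat; auto; apply Rdiv_lt_0_compat; lra).
  assert (Pe := exp_ineq1 _ ltac:(apply Rgt_not_eq; exact Pw)).
  assert (T := Cmod_sub_le (kerw h (x, y)) 1).
  rewrite Cmod_kerw, Cmod_1 in T.
  replace (kerw h (x, y) - 1)%C with (- (1 - kerw h (x, y)))%C in T by ring.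
  rewrite Cmod_opp in T.
  assert (N : (1 - kerw h (x, y))%C <> 0) by (apply Cmod_gt_0; lra).
  split; auto. unfold ker. rewrite Cmod_inv by auto. apply Rinv_le_contravar; lra.
Qed.

(** With w the value of [kerw], ker - 1 = w / (1 - w). Since |w| is the reciprocal of its value at
    the mirrored height, the bound coincides with the one above the axis. *)
Lemma ker_bound_down (h x y : R) : 0 < h -> 0 < y ->
  (1 - kerw h (x, (- y)%R))%C <> 0 /\
  Cmod (ker h (x, (- y)%R) - 1) <= / (exp (2 * PI / h * y) - 1).
Proof.
  intros Hh Hy. assert (Pp := PI_RGT_0).
  assert (Pw : 0 < 2 * PI / h * y) by (apply Rmult_lt_0_compat; auto; apply Rdiv_lt_0_compat; lra).
  assert (Pe := exp_ineq1 _ ltac:(apply Rgt_not_eq; exact Pw)).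
  assert (EW : Cmod (kerw h (x, (- y)%R)) = / exp (2 * PI / h * y)).
  { rewrite Cmod_kerw. rewrite <- exp_Ropp. f_equal; ring. }
  set (E := exp (2 * PI / h * y)) in *.
  assert (PE : 0 < / E < 1).
  { split; [apply Rinv_0_lt_compat; lra|]. rewrite <- Rinv_1. apply Rinv_lt_contravar; lra. }
  assert (T := Cmod_sub_le 1 (kerw h (x, (- y)%R))). rewrite EW, Cmod_1 in T.
  assert (N : (1 - kerw h (x, (- y)%R))%C <> 0) by (apply Cmod_gt_0; lra).
  split; auto.
  replace (ker h (x, (- y)%R) - 1)%C with (kerw h (x, (- y)%R) / (1 - kerw h (x, (- y)%R)))%C by (unfold ker; field; auto).
  rewrite Cmod_div, EW by auto.
  apply Rle_trans with (/ E / (1 - / E)).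
  - unfold Rdiv. apply Rmult_le_compat_l; [lra|]. apply Rinv_le_contravar; lra.
  - right. field. lra.
Qed.

(** Off the real axis the modulus of [kerw] differs from 1. On the axis its real part is cos(2 pi x
    / h), which is below 1 for 0 < |x| <= h / 2, because the cosine decreases on [0, pi]. *)
Lemma kerw_ne_1 (h x y : R) : 0 < h -> - (h / 2) <= x <= h / 2 -> x <> 0 \/ y <> 0 ->
  (1 - kerw h (x, y))%C <> 0.
Proof.
  intros Hh Hx Hxy. assert (Pp := PI_RGT_0).
  destruct (Rtotal_order y 0) as [L|[->|L]].
  - replace y with (- - y) by ring. apply (ker_bound_down h x (-y)); lra.
  - rewrite kerw_pair. intros E.
    assert (E1 : 1 - exp (2 * PI / h * 0) * cos (2 * PI / h * x) = 0) by exact (f_equal fst E).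
    rewrite Rmult_0_r, exp_0 in E1.
    assert (Px : 0 < 2 * PI / h * Rabs x <= PI).
    { assert (0 < Rabs x) by (apply Rabs_pos_lt; lra).
      assert (Rabs x <= h / 2) by (apply Rabs_le; lra).
      assert (P1 : 0 < 2 * PI / h) by (apply Rdiv_lt_0_compat; lra).
      split; [apply Rmult_lt_0_compat; auto|].
      replace PI with (2 * PI / h * (h / 2)) at 2 by (field; lra).
      apply Rmult_le_compat_l; lra. }
    assert (EC : cos (2 * PI / h * x) = cos (2 * PI / h * Rabs x)).
    { unfold Rabs; destruct (Rcase_abs x); auto. rewrite <- cos_neg. f_equal; ring. }
    assert (cos (2 * PI / h * Rabs x) < cos 0) by (apply cos_decreasing_1; lra).
    rewrite cos_0 in H. lra.
  - apply (ker_bound_up h x y); lra.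
Qed.

(** Half a period away from the pole the oscillating factor is e^(-i pi) or e^(i pi), both equal to
    -1. *)
Lemma kerw_side (h y : R) : 0 < h ->
  kerw h ((h / 2)%R, y) = RtoC (- exp (2 * PI / h * y)) /\
  kerw h ((- (h / 2))%R, y) = RtoC (- exp (2 * PI / h * y)).
Proof.
  intros Hh. rewrite !kerw_pair.
  replace (2 * PI / h * (h / 2)) with PI by (field; lra).
  replace (2 * PI / h * - (h / 2)) with (- PI) by (field; lra).
  rewrite cos_neg, sin_neg, cos_PI, sin_PI. split; cring.
Qed.

Lemma ker_side (h y : R) : 0 < h ->
  ker h ((h / 2)%R, y) = RtoC (/ (1 + exp (2 * PI / h * y))) /\
  ker h ((- (h / 2))%R, y) = RtoC (/ (1 + exp (2 * PI / h * y))).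
Proof.
  intros Hh. unfold ker. destruct (kerw_side h y Hh) as [-> ->].
  assert (P := exp_pos (2 * PI / h * y)).
  rewrite RtoC_inv by lra.
  rewrite <- RtoC_minus. replace (1 - - exp (2 * PI / h * y)) with (1 + exp (2 * PI / h * y)) by ring.
  auto.
Qed.

Lemma ccont_ker (h x y : R) : 0 < h -> - (h / 2) <= x <= h / 2 -> x <> 0 \/ y <> 0 ->
  ccont (ker h) (x, y).
Proof. intros. apply cdiff_ccont, cdiff_ker, kerw_ne_1; auto. Qed.

(* By periodicity the integral does not depend on y, and it tends to 0 as y grows. *)
Lemma ker_line_up (h y : R) : 0 < h -> 0 < y ->
  CI (fun x => ker h (x, y)) (- (h / 2)) (h / 2) = 0.
Proof.
  intros Hh Hy. assert (Pp := PI_RGT_0). apply NNPP; intros N. apply Cmod_gt_0 in N.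
  set (r := Cmod _) in N.
  assert (P1 : 0 < 2 * PI / h) by (apply Rdiv_lt_0_compat; lra).
  (* At this height 2 pi Y / h exceeds h / r. As e^t - 1 is at least t, the bound on the integral
     drops below [r]. *)
  set (Y := y + h / (2 * PI / h * r) ).
  assert (P2 : 0 < h / (2 * PI / h * r)) by (apply Rdiv_lt_0_compat; auto; apply Rmult_lt_0_compat; auto).
  assert (G : rectI (ker h) (-(h/2)) (h/2) y Y = 0).
  { apply goursat; try (unfold Y; lra). intros; apply cdiff_ker, kerw_ne_1; auto; lra. }
  unfold rectI in G.
  rewrite (CI_ext (fun y0 => ker h ((h / 2)%R, y0)) (fun y0 => ker h ((- (h / 2))%R, y0))) in G.
  2:{ intros t _. destruct (ker_side h t Hh) as [-> ->]; auto. }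
  assert (G2 : CI (fun x => ker h (x, y)) (- (h / 2)) (h / 2) = CI (fun x => ker h (x, Y)) (- (h / 2)) (h / 2)).
  { match type of G with (?p - ?q + _)%C = _ => replace p with (q + (p - q + Ci * (CI (fun y0 => ker h ((- (h / 2))%R, y0)) y Y - CI (fun y0 => ker h ((- (h / 2))%R, y0)) y Y)))%C by ring end.
    rewrite G; ring. }
  assert (PY : 0 < Y) by (unfold Y; lra).
  assert (B : Cmod (CI (fun x => ker h (x, Y)) (- (h / 2)) (h / 2)) <= (h / 2 - - (h / 2)) * / (exp (2 * PI / h * Y) - 1)).
  { apply CI_norm_const; [lra| |].
    - intros x _. apply ker_bound_up; auto.
    - apply CIex_h; [lra|]. intros; apply ccont_ker; auto; lra. }
  rewrite <- G2 in B. fold r in B.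
  assert (PW : 0 < 2 * PI / h * Y) by (apply Rmult_lt_0_compat; auto).
  assert (Pe := exp_ineq1 _ ltac:(apply Rgt_not_eq; exact PW)).
  assert (B2 : h * / (exp (2 * PI / h * Y) - 1) < h * / (h / r)).
  { apply Rmult_lt_compat_l; auto. apply Rinv_lt_contravar.
    - apply Rmult_lt_0_compat; [apply Rdiv_lt_0_compat; auto|lra].
    - apply Rlt_trans with (2 * PI / h * Y); [|lra].
      unfold Y. rewrite Rmult_plus_distr_l.
      replace (2 * PI / h * (h / (2 * PI / h * r))) with (h / r) by (field; lra).
      assert (0 < 2 * PI / h * y) by (apply Rmult_lt_0_compat; auto). lra. }
  replace (h * / (h / r)) with r in B2 by (field; lra).
  replace (h / 2 - - (h / 2)) with h in B by lra. lra.
Qed.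

(** The argument of [ker_line_up], run downwards with [ker - 1], which tends to 0 there; the
    subtracted 1 accounts for the period length [h]. *)
Lemma ker_line_down (h y : R) : 0 < h -> 0 < y ->
  CI (fun x => ker h (x, (- y)%R)) (- (h / 2)) (h / 2) = RtoC h.
Proof.
  intros Hh Hy. assert (Pp := PI_RGT_0).
  assert (Q : forall Y, 0 < Y -> CI (fun x => ker h (x, (- Y)%R) - 1)%C (- (h / 2)) (h / 2)
     = (CI (fun x => ker h (x, (- Y)%R)) (- (h / 2)) (h / 2) - RtoC h)%C).
  { intros Y PY. rewrite CI_minus.
    - f_equal. assert (A := CI_affine 0 1 (-(h/2)) (h/2)).
      rewrite (CI_ext (fun _ => RtoC 1) (fun t => 0 * RtoC t + 1)%C) by (intros; ring).
      rewrite A. apply Ceq_ext; unfold Re, Im; simpl; field.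
    - apply CIex_h; [lra|]. intros; apply ccont_ker; auto; lra.
    - apply (CIex_h (fun _ => RtoC 1) (-(h/2)) (h/2) 0); [lra|]. intros; apply ccont_const. }
  apply NNPP; intros N0.
  assert (N : (CI (fun x => ker h (x, (- y)%R)) (- (h / 2)) (h / 2) - RtoC h)%C <> 0).
  { intro E. apply N0. match goal with |- ?a = ?b => replace a with (a - b + b)%C by ring end. rewrite E; ring. }
  apply Cmod_gt_0 in N. set (r := Cmod _) in N.
  assert (P1 : 0 < 2 * PI / h) by (apply Rdiv_lt_0_compat; lra).
  set (Y := y + h / (2 * PI / h * r) ).
  assert (P2 : 0 < h / (2 * PI / h * r)) by (apply Rdiv_lt_0_compat; auto; apply Rmult_lt_0_compat; auto).
  assert (G : rectI (ker h) (-(h/2)) (h/2) (-Y) (-y) = 0).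
  { apply goursat; try (unfold Y; lra). intros; apply cdiff_ker, kerw_ne_1; auto; lra. }
  unfold rectI in G.
  rewrite (CI_ext (fun y0 => ker h ((h / 2)%R, y0)) (fun y0 => ker h ((- (h / 2))%R, y0))) in G.
  2:{ intros t _. destruct (ker_side h t Hh) as [-> ->]; auto. }
  assert (G2 : CI (fun x => ker h (x, (- Y)%R)) (- (h / 2)) (h / 2) = CI (fun x => ker h (x, (- y)%R)) (- (h / 2)) (h / 2)).
  { match type of G with (?p - ?q + _)%C = _ => replace p with (q + (p - q + Ci * (CI (fun y0 => ker h ((- (h / 2))%R, y0)) (-Y) (-y) - CI (fun y0 => ker h ((- (h / 2))%R, y0)) (-Y) (-y))))%C by ring end.
    rewrite G; ring. }
  assert (PY : 0 < Y) by (unfold Y; lra).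
  assert (B : Cmod (CI (fun x => ker h (x, (- Y)%R) - 1)%C (- (h / 2)) (h / 2)) <= (h / 2 - - (h / 2)) * / (exp (2 * PI / h * Y) - 1)).
  { apply CI_norm_const; [lra| |].
    - intros x _. apply ker_bound_down; auto.
    - apply (CIex_h (fun z => ker h z - 1)%C); [lra|]. intros; apply ccont_plus; [|apply ccont_const].
      apply ccont_ker; auto; lra. }
  rewrite (Q Y PY), G2 in B. fold r in B.
  assert (PW : 0 < 2 * PI / h * Y) by (apply Rmult_lt_0_compat; auto).
  assert (Pe := exp_ineq1 _ ltac:(apply Rgt_not_eq; exact PW)).
  assert (B2 : h * / (exp (2 * PI / h * Y) - 1) < h * / (h / r)).
  { apply Rmult_lt_compat_l; auto. apply Rinv_lt_contravar.
    - apply Rmult_lt_0_compat; [apply Rdiv_lt_0_compat; auto|lra].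
    - apply Rlt_trans with (2 * PI / h * Y); [|lra].
      unfold Y. rewrite Rmult_plus_distr_l.
      replace (2 * PI / h * (h / (2 * PI / h * r))) with (h / r) by (field; lra).
      assert (0 < 2 * PI / h * y) by (apply Rmult_lt_0_compat; auto). lra. }
  replace (h * / (h / r)) with r in B2 by (field; lra).
  replace (h / 2 - - (h / 2)) with h in B by lra. lra.
Qed.

(** Plays the part of the residue at 0: the vertical sides cancel by periodicity, the upper line
    contributes nothing, and the lower line gives [h]. *)
Lemma rectI_ker (h e : R) : 0 < h -> 0 < e ->
  rectI (ker h) (- (h / 2)) (h / 2) (- e) e = RtoC h.
Proof.
  intros Hh He. unfold rectI. rewrite (ker_line_up h e), (ker_line_down h e) by auto.
  rewrite (CI_ext (fun y0 => ker h ((h / 2)%R, y0)) (fun y0 => ker h ((- (h / 2))%R, y0))).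
  2:{ intros t _. destruct (ker_side h t Hh) as [-> ->]; auto. }
  ring.
Qed.

(* Near 0 the zero of 1 - kerw is simple, which bounds (F z - F 0) * ker h z. *)
Lemma kerw_lower (h : R) : 0 < h -> exists del, 0 < del /\
  forall u : C, Cmod u < del -> PI / h * Cmod u <= Cmod (1 - kerw h u).
Proof.
  intros Hh. assert (Pp := PI_RGT_0).
  destruct (cexp_near_0 (1/2)) as [d [Hd H]]; [lra|].
  assert (P1 : 0 < 2 * PI / h) by (apply Rdiv_lt_0_compat; lra).
  exists (d / (2 * PI / h)). split; [apply Rdiv_lt_0_compat; auto|].
  intros u Hu. set (v := (RtoC (2 * PI / h) * (- Ci * u))%C).
  assert (Ev : Cmod v = 2 * PI / h * Cmod u).
  { unfold v. rewrite !Cmod_mult, Cmod_R, Cmod_opp, Cmod_Ci, Rabs_pos_eq by lra. ring. }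
  assert (Hv : Cmod v < d).
  { rewrite Ev. apply Rmult_lt_compat_l with (r := 2 * PI / h) in Hu; auto.
    replace (2 * PI / h * (d / (2 * PI / h))) with d in Hu by (field; lra). auto. }
  specialize (H v Hv). unfold kerw. fold v.
  assert (T := Cmod_sum_le (cexp v - 1) (cexp v - 1 - v)).
  replace (cexp v - 1 - (cexp v - 1 - v))%C with v in T by ring.
  replace (cexp v - 1)%C with (- (1 - cexp v))%C in T at 1 by ring.
  rewrite Cmod_opp in T. rewrite Ev in *.
  replace (PI / h * Cmod u) with (1 / 2 * (2 * PI / h * Cmod u)) by (field; lra). lra.
Qed.

(** Writing F = F(0) + (F - F(0)), the product of the second part with the kernel stays bounded near
    0 and integrates to 0. What remains is the constant F(0) times the contour integral of the
    kernel itself. *)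
Lemma residue_ker (F : C -> C) (h e : R) : 0 < h -> 0 < e ->
  (forall x y, - (h / 2) <= x <= h / 2 -> - e <= y <= e -> cdiff F (x, y)) ->
  rectI (fun z => F z * ker h z)%C (- (h / 2)) (h / 2) (- e) e = (RtoC h * F 0)%C.
Proof.
  intros Hh He HF. assert (Pp := PI_RGT_0).
  destruct (HF 0 0) as [phi [Hphi [d1 [Hd1 H1]]]]; try lra.
  destruct (Hphi 1 Rlt_0_1) as [d2 [Hd2 H2]].
  destruct (kerw_lower h Hh) as [d3 [Hd3 H3]].
  change ((0, 0) : C) with (RtoC 0) in *.
  assert (P1 : 0 < PI / h) by (apply Rdiv_lt_0_compat; lra).
  assert (Z : rectI (fun z => 1 * (F z * ker h z) + (- F 0) * ker h z)%C (- (h / 2)) (h / 2) (- e) e = 0).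
  (* The first factor bounds |phi u| near 0, the second bounds |u ker(u)| by means of
     [kerw_lower]. *)
  { apply goursat_punctured with ((Cmod (phi 0) + 1) * / (PI / h)) (Rmin d1 (Rmin d2 d3)); try lra.
    - repeat apply Rmin_glb_lt; auto.
    - intros x y Hx Hy Hxy.
      assert (K : cdiff (ker h) (x, y)) by (apply cdiff_ker, kerw_ne_1; auto).
      apply cdiff_plus; apply cdiff_mult; auto; try apply cdiff_const. apply cdiff_mult; auto.
    - intros u Nu Hu. apply Rmin_Rgt_l in Hu. destruct Hu as [U1 Hu].
      apply Rmin_Rgt_l in Hu. destruct Hu as [U2 U3].
      assert (Eu : (u - 0)%C = u) by ring.
      specialize (H1 u). specialize (H2 u). rewrite Eu in *. specialize (H3 u U3).
      rewrite H1 by auto.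
      replace (1 * ((F 0 + phi u * u) * ker h u) + - F 0 * ker h u)%C with (phi u * (u * ker h u))%C by ring.
      rewrite !Cmod_mult. apply Rmult_le_compat; try apply Cmod_ge_0.
      { apply Rmult_le_pos; apply Cmod_ge_0. }
      { assert (T := Cmod_sub_le (phi u) (phi 0)). specialize (H2 ltac:(lra)). lra. }
      assert (Pu : 0 < Cmod u) by (apply Cmod_gt_0; auto).
      assert (Pk : 0 < PI / h * Cmod u) by (apply Rmult_lt_0_compat; auto).
      unfold ker. rewrite Cmod_inv by (apply Cmod_gt_0; lra).
      apply Rle_trans with (Cmod u * / (PI / h * Cmod u)).
      + apply Rmult_le_compat_l; [lra|]. apply Rinv_le_contravar; auto.
      + right. field. lra. }
  rewrite rectI_lin, rectI_ker in Z; auto; try lra.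
  - replace (rectI (fun z => F z * ker h z)%C (- (h / 2)) (h / 2) (- e) e)
      with (1 * rectI (fun z => F z * ker h z)%C (- (h / 2)) (h / 2) (- e) e + - F 0 * RtoC h + RtoC h * F 0)%C by ring.
    rewrite Z. ring.
  - intros x y [A1 [A2 A3]]. apply ccont_mult; [apply cdiff_ccont; auto|apply ccont_ker; auto; lra].
  - intros x y [A1 [A2 A3]]. apply ccont_ker; auto; lra.
Qed.

(* The weight is the value of ker h at Re z = -h/2 and h/2; the second integral comes from moving the integral of F to the real axis. *)
Definition sideV (F : C -> C) (h e s : R) : C :=
  (Ci * (CI (fun y => F (s, y) * RtoC (/ (1 + exp (2 * PI / h * y)))) (- e) e
         - CI (fun y => F (s, y)) (- e) 0))%C.

(** On the lower line [ker] is near 1, so it is split as (ker - 1) + 1. Cauchy's theorem below the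
    axis moves the integral of F left over from the 1 up to the real axis; the vertical pieces
    produced on the way are merged into [sideV]. *)
Lemma cell_identity (F : C -> C) (h e : R) : 0 < h -> 0 < e ->
  (forall x y, - (h / 2) <= x <= h / 2 -> - e <= y <= e -> cdiff F (x, y)) ->
  (RtoC h * F 0 - CI (fun x => F (x, 0)) (- (h / 2)) (h / 2) =
   CI (fun x => F (x, (- e)%R) * (ker h (x, (- e)%R) - 1)) (- (h / 2)) (h / 2)
   - CI (fun x => F (x, e) * ker h (x, e)) (- (h / 2)) (h / 2)
   + (sideV F h e (h / 2) - sideV F h e (- (h / 2))))%C.
Proof.
  intros Hh He HF.
  assert (CF : forall x y, - (h / 2) <= x <= h / 2 -> - e <= y <= e -> ccont F (x, y))
    by (intros; apply cdiff_ccont; auto).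
  assert (R1 := residue_ker F h e Hh He HF).
  assert (R2 : rectI F (- (h / 2)) (h / 2) (- e) 0 = 0).
  { apply goursat; try lra. intros; apply HF; lra. }
  rewrite <- R1.
  replace (CI (fun x => F (x, (- e)%R) * (ker h (x, (- e)%R) - 1)) (- (h / 2)) (h / 2))%C
    with (CI (fun x => F (x, (- e)%R) * ker h (x, (- e)%R)) (- (h / 2)) (h / 2)
          - CI (fun x => F (x, (- e)%R)) (- (h / 2)) (h / 2))%C.
  2:{ rewrite <- CI_minus.
      - apply CI_ext; intros; ring.
      - apply (CIex_h (fun z => F z * ker h z)%C); [lra|]. intros; apply ccont_mult; [apply CF; lra|apply ccont_ker; auto; lra].
      - apply CIex_h; [lra|]. intros; apply CF; lra. }
  unfold sideV.
  rewrite (CI_ext (fun y => F ((h / 2)%R, y) * RtoC (/ (1 + exp (2 * PI / h * y))))%C (fun y => F ((h / 2)%R, y) * ker h ((h / 2)%R, y))%C).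
  2:{ intros y _. destruct (ker_side h y Hh) as [-> _]. reflexivity. }
  rewrite (CI_ext (fun y => F ((- (h / 2))%R, y) * RtoC (/ (1 + exp (2 * PI / h * y))))%C (fun y => F ((- (h / 2))%R, y) * ker h ((- (h / 2))%R, y))%C).
  2:{ intros y _. destruct (ker_side h y Hh) as [_ ->]. reflexivity. }
  unfold rectI in *.
  (* [b] is the integral of [F] along the real axis; [R2] expresses it through the lower line and
     the two vertical segments. *)
  match type of R2 with (?A - ?B + ?D)%C = _ => set (a := A) in *; set (b := B) in *;
    replace b with (a + D)%C by (replace (RtoC 0) with (a - b + D)%C by exact R2;
      transitivity (b + (a - b + D))%C; [ring | rewrite R2; ring]) end.
  ring.
Qed.

(** * The trapezoidal rule on a strip *)

Lemma RInt_shift (g : R -> R) (p a b : R) : ex_RInt g (a + p) (b + p) ->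
  ex_RInt (fun x => g (x + p)) a b /\ RInt (fun x => g (x + p)) a b = RInt g (a + p) (b + p).
Proof.
  intros H. apply (RInt_correct (V := R_CompleteNormedModule)) in H.
  assert (I : is_RInt (fun x => g (x + p)) a b (RInt g (a + p) (b + p))).
  { apply (is_RInt_ext (V := R_NormedModule) (fun x => scal 1 (g (1 * x + p)))).
    - intros x _. unfold scal; simpl; unfold mult; simpl. rewrite !Rmult_1_l. reflexivity.
    - apply (is_RInt_comp_lin (V := R_NormedModule)). rewrite !Rmult_1_l. exact H. }
  split; [eexists; exact I|apply is_RInt_unique, I].
Qed.

Lemma CI_shift (f : R -> C) (p a b : R) : CIex f (a + p) (b + p) ->
  CI (fun x => f (x + p)) a b = CI f (a + p) (b + p).
Proof.
  intros [H1 H2]. unfold CI. f_equal.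
  - apply (RInt_shift (fun t => Re (f t))); auto.
  - apply (RInt_shift (fun t => Im (f t))); auto.
Qed.

Lemma sum_MN_0 (g : Z -> C) : sum_MN 0 0 g = g 0%Z.
Proof. unfold sum_MN. simpl. rewrite sum_O. reflexivity. Qed.

Lemma sum_MN_S_r (M N : nat) (g : Z -> C) :
  sum_MN M (S N) g = (sum_MN M N g + g (Z.of_nat (S N)))%C.
Proof.
  unfold sum_MN. rewrite Nat.add_succ_r, sum_Sn.
  replace (Z.of_nat (S (M + N)) - Z.of_nat M)%Z with (Z.of_nat (S N)) by lia. reflexivity.
Qed.

Lemma sum_MN_S_l (M N : nat) (g : Z -> C) :
  sum_MN (S M) N g = (sum_MN M N g + g (- Z.of_nat (S M))%Z)%C.
Proof.
  unfold sum_MN. rewrite Nat.add_succ_l. unfold sum_n. rewrite sum_Sn_m by lia.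
  rewrite <- sum_n_m_S.
  rewrite (sum_n_m_ext (fun n : nat => g (Z.of_nat (S n) - Z.of_nat (S M))%Z)
     (fun j : nat => g (Z.of_nat j - Z.of_nat M)%Z)).
  2:{ intros j. f_equal. lia. }
  replace (Z.of_nat 0 - Z.of_nat (S M))%Z with (- Z.of_nat (S M))%Z by lia.
  apply Cplus_comm.
Qed.

Lemma ex_RInt_exp_abs (mu a b : R) : ex_RInt (fun x => exp (- mu * Rabs x)) a b.
Proof.
  apply (ex_RInt_continuous (V := R_CompleteNormedModule)). intros z _.
  apply (continuous_comp (fun x => - mu * Rabs x) exp).
  - apply (continuous_scal_r (V := R_NormedModule) (- mu) Rabs). apply continuous_Rabs.
  - apply continuity_pt_filterlim. apply derivable_continuous, derivable_exp.
Qed.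

Lemma is_RInt_exp_lin (k a b : R) : k <> 0 ->
  is_RInt (fun x => exp (k * x)) a b (exp (k * b) / k - exp (k * a) / k).
Proof.
  intros Hk. apply (is_RInt_derive (fun x => exp (k * x) / k) (fun x => exp (k * x))).
  - intros x _. auto_derive; auto. field; auto.
  - intros x _. apply (continuous_comp (fun x => k * x) exp).
    + apply (continuous_scal_r (V := R_NormedModule) k (fun x => x)). apply continuous_id.
    + apply continuity_pt_filterlim. apply derivable_continuous, derivable_exp.
Qed.

Lemma RInt_exp_abs_le (mu a b : R) : 0 < mu -> a <= 0 <= b ->
  RInt (fun x => exp (- mu * Rabs x)) a b <= 2 / mu.
Proof.
  intros Hmu Hab.
  rewrite <- (RInt_Chasles (V := R_CompleteNormedModule) _ a 0 b) by apply ex_RInt_exp_abs.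
  rewrite (RInt_ext _ (fun x => exp (mu * x)) a 0).
  2:{ intros x. rewrite Rmin_left, Rmax_right by lra. intros Hx.
      rewrite Rabs_left by lra. f_equal; ring. }
  rewrite (RInt_ext _ (fun x => exp (- mu * x)) 0 b).
  2:{ intros x. rewrite Rmin_left, Rmax_right by lra. intros Hx.
      rewrite Rabs_pos_eq by lra. reflexivity. }
  rewrite (is_RInt_unique _ _ _ _ (is_RInt_exp_lin mu a 0 ltac:(lra))).
  rewrite (is_RInt_unique _ _ _ _ (is_RInt_exp_lin (- mu) 0 b ltac:(lra))).
  rewrite !Rmult_0_r, exp_0. unfold plus; simpl.
  assert (P1 := exp_pos (mu * a)). assert (P2 := exp_pos (- mu * b)).
  assert (Q1 : 0 < exp (mu * a) / mu) by (apply Rdiv_lt_0_compat; auto).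
  assert (Q2 : 0 < exp (- mu * b) / mu) by (apply Rdiv_lt_0_compat; auto).
  replace (1 / mu - exp (mu * a) / mu + (exp (- mu * b) / - mu - 1 / - mu))
    with (2 / mu - exp (mu * a) / mu - exp (- mu * b) / mu) by (field; lra).
  lra.
Qed.

Section Trapezoid.

Variables (F : C -> C) (h e B mu : R).
Hypothesis Hh : 0 < h.
Hypothesis He : 0 < e.
Hypothesis HB : 0 <= B.
Hypothesis Hmu : 0 < mu.
Hypothesis HF : forall x y, - e <= y <= e -> cdiff F (x, y).
Hypothesis HFB : forall x y, - e <= y <= e -> Cmod (F (x, y)) <= B * exp (- mu * Rabs x).

(** The common bound for [ker] on the upper line and for [ker - 1] on the lower line. *)
Let q := / (exp (2 * PI / h * e) - 1).
Let bd (x : R) := exp (- mu * Rabs x).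

Let HFc x y : - e <= y <= e -> ccont F (x, y).
Proof. intros; apply cdiff_ccont; auto. Qed.

(** Translating [F] by [p] reduces to the cell around 0. The side terms stay inside the modulus:
    estimated cell by cell, they would leave a sum that does not vanish as the number of cells
    grows. *)
Lemma cell_error (p : R) :
  Cmod (RtoC h * F (RtoC p) - CI (fun x => F (x, 0)) (p - h / 2) (p + h / 2)
    - (sideV F h e (p + h / 2) - sideV F h e (p - h / 2)))%C
  <= 2 * B * q * RInt bd (p - h / 2) (p + h / 2).
Proof.
  set (G := fun z => F (z + RtoC p)%C).
  assert (EG : forall x y, G (x, y) = F (x + p, y)).
  { intros. unfold G. f_equal. cring. }
  assert (HG : forall x y, - e <= y <= e -> cdiff G (x, y)).
  { intros x y Hy. unfold G. apply (cdiff_comp F (fun z => z + RtoC p)%C).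
    - apply cdiff_plus; [apply cdiff_id|apply cdiff_const].
    - replace ((x, y) + RtoC p)%C with ((x + p, y) : C) by cring. apply HF; auto. }
  assert (ID := cell_identity G h e Hh He ltac:(intros; apply HG; auto)).
  assert (ES : forall s, sideV G h e s = sideV F h e (s + p)).
  { intros s. unfold sideV.
    rewrite (CI_ext (fun y => G (s, y) * RtoC (/ (1 + exp (2 * PI / h * y))))%C
       (fun y => F ((s + p)%R, y) * RtoC (/ (1 + exp (2 * PI / h * y))))%C) by (intros; rewrite EG; auto).
    rewrite (CI_ext (fun y => G (s, y)) (fun y => F ((s + p)%R, y))) by (intros; rewrite EG; auto).
    reflexivity. }
  rewrite !ES in ID.
  replace (G 0) with (F (RtoC p)) in ID by (unfold G; f_equal; ring).
  assert (EI : CI (fun x => G (x, 0)) (- (h / 2)) (h / 2) = CI (fun x => F (x, 0)) (p - h / 2) (p + h / 2)).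
  { rewrite (CI_ext (fun x => G (x, 0)) (fun x => F (x + p, 0))) by (intros; auto).
    rewrite (CI_shift (fun x => F (x, 0)) p).
    - f_equal; ring.
    - apply CIex_h; [lra|]. intros; apply HFc; lra. }
  rewrite EI in ID.
  replace (h / 2 + p) with (p + h / 2) in ID by ring.
  replace (- (h / 2) + p) with (p - h / 2) in ID by ring.
  rewrite ID.
  match goal with |- Cmod ?u <= _ => replace u with
     (CI (fun x => G (x, (- e)%R) * (ker h (x, (- e)%R) - 1)) (- (h / 2)) (h / 2) -
      CI (fun x => G (x, e) * ker h (x, e)) (- (h / 2)) (h / 2))%C by ring end.
  eapply Rle_trans; [apply Cmod_sum_le|].
  assert (ExB : ex_RInt bd (- (h / 2) + p) (h / 2 + p)) by apply ex_RInt_exp_abs.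
  destruct (RInt_shift bd p _ _ ExB) as [ExS ES2].
  assert (Ex2 : ex_RInt (fun x => scal (B * q) (bd (x + p))) (- (h / 2)) (h / 2)).
  { apply (ex_RInt_scal (V := R_NormedModule)); auto. }
  assert (EV : RInt (fun x => scal (B * q) (bd (x + p))) (- (h / 2)) (h / 2) = B * q * RInt bd (p - h / 2) (p + h / 2)).
  { apply is_RInt_unique. change (B * q * RInt bd (p - h / 2) (p + h / 2)) with (scal (B * q) (RInt bd (p - h / 2) (p + h / 2))).
    apply (is_RInt_scal (V := R_NormedModule)).
    replace (RInt bd (p - h / 2) (p + h / 2)) with (RInt (fun x => bd (x + p)) (- (h / 2)) (h / 2));
      [apply (RInt_correct (V := R_CompleteNormedModule)); auto|].
    rewrite ES2. replace (h / 2 + p) with (p + h / 2) by ring.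
    replace (- (h / 2) + p) with (p - h / 2) by ring. reflexivity. }
  assert (GB : forall x y, - e <= y <= e -> Cmod (G (x, y)) <= B * bd (x + p)).
  { intros. rewrite EG. apply HFB; auto. }
  replace (2 * B * q * RInt bd (p - h / 2) (p + h / 2))
    with (B * q * RInt bd (p - h / 2) (p + h / 2) + B * q * RInt bd (p - h / 2) (p + h / 2)) by ring.
  rewrite <- EV.
  apply Rplus_le_compat; (apply CI_norm; [lra| | |exact Ex2]).
  - intros x Hx. rewrite Cmod_mult.
    replace (scal (B * q) (bd (x + p))) with (B * bd (x + p) * q)
      by (unfold scal; simpl; unfold mult; simpl; ring).
    apply Rmult_le_compat; try apply Cmod_ge_0; [apply GB; lra|apply ker_bound_down; auto].
  - apply (CIex_h (fun z => G z * (ker h z - 1))%C); [lra|]. intros x Hx.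
    apply ccont_mult; [apply cdiff_ccont, HG; lra|].
    apply ccont_plus; [apply ccont_ker; auto; lra|apply ccont_const].
  - intros x Hx. rewrite Cmod_mult.
    replace (scal (B * q) (bd (x + p))) with (B * bd (x + p) * q)
      by (unfold scal; simpl; unfold mult; simpl; ring).
    apply Rmult_le_compat; try apply Cmod_ge_0; [apply GB; lra|apply ker_bound_up; auto].
  - apply (CIex_h (fun z => G z * ker h z)%C); [lra|]. intros x Hx.
    apply ccont_mult; [apply cdiff_ccont, HG; lra|apply ccont_ker; auto; lra].
Qed.

(** Cells are first added on the left, with [Q] equal to 0, and then on the right. Neighbouring
    cells share a side, so of all the [sideV] terms only the outermost two survive. *)
Lemma cells_error (P Q : nat) :
  let a := - ((INR P + 1 / 2) * h) in
  let b := (INR Q + 1 / 2) * h in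
  Cmod (RtoC h * sum_MN P Q (fun k => F (RtoC (IZR k * h)))
    - CI (fun x => F (x, 0)) a b - (sideV F h e b - sideV F h e a))%C
  <= 2 * B * q * RInt bd a b.
Proof.
  assert (CX : forall a b, a <= b -> CIex (fun x => F (x, 0)) a b).
  { intros; apply CIex_h; auto. intros; apply HFc; lra. }
  assert (BX : forall a b, ex_RInt bd a b) by (intros; apply ex_RInt_exp_abs).
  induction Q as [|Q IHQ].
  - induction P as [|P IHP].
    + cbv zeta. rewrite sum_MN_0. simpl INR.
      assert (H := cell_error 0).
      replace (0 - h / 2) with (- ((0 + 1 / 2) * h)) in H by lra.
      replace (0 + h / 2) with ((0 + 1 / 2) * h) in H by lra.
      replace (IZR 0 * h) with 0 by (simpl; ring). exact H.
    + cbv zeta in *. rewrite sum_MN_S_l.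
      assert (H := cell_error (IZR (- Z.of_nat (S P)) * h)).
      set (p := IZR (- Z.of_nat (S P)) * h) in *.
      assert (Ep : p = - (INR P + 1) * h).
      { unfold p. rewrite opp_IZR, <- INR_IZR_INZ, S_INR. reflexivity. }
      rewrite S_INR.
      replace (p - h / 2) with (- ((INR P + 1 + 1 / 2) * h)) in H by (rewrite Ep; field).
      replace (p + h / 2) with (- ((INR P + 1 / 2) * h)) in H by (rewrite Ep; field).
      assert (PP := pos_INR P).
      set (a0 := - ((INR P + 1 / 2) * h)) in *. set (a1 := - ((INR P + 1 + 1 / 2) * h)) in *.
      set (b := (INR 0 + 1 / 2) * h) in *.
      assert (O1 : a1 <= a0) by (unfold a0, a1; nra).
      assert (O2 : a0 <= b) by (unfold a0, b; simpl; nra).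
      rewrite <- (CI_Chasles _ a1 a0 b) by (apply CX; auto).
      rewrite <- (RInt_Chasles (V := R_CompleteNormedModule) bd a1 a0 b) by auto.
      unfold plus; simpl AbelianMonoid.plus.
      rewrite Rmult_plus_distr_l.
      eapply Rle_trans; [|apply Rplus_le_compat; [exact H|exact IHP]].
      eapply Rle_trans; [|apply Cmod_triangle]. right. f_equal. ring.
  - cbv zeta in *. rewrite sum_MN_S_r.
    assert (H := cell_error (IZR (Z.of_nat (S Q)) * h)).
    set (p := IZR (Z.of_nat (S Q)) * h) in *.
    assert (Ep : p = (INR Q + 1) * h).
    { unfold p. rewrite <- INR_IZR_INZ, S_INR. reflexivity. }
    rewrite S_INR.
    replace (p - h / 2) with ((INR Q + 1 / 2) * h) in H by (rewrite Ep; field).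
    replace (p + h / 2) with ((INR Q + 1 + 1 / 2) * h) in H by (rewrite Ep; field).
    assert (PP := pos_INR P). assert (PQ := pos_INR Q).
    set (a := - ((INR P + 1 / 2) * h)) in *. set (b1 := (INR Q + 1 + 1 / 2) * h) in *.
    set (b0 := (INR Q + 1 / 2) * h) in *.
    assert (O1 : b0 <= b1) by (unfold b0, b1; nra).
    assert (O2 : a <= b0) by (unfold a, b0; nra).
    rewrite <- (CI_Chasles _ a b0 b1) by (apply CX; auto).
    rewrite <- (RInt_Chasles (V := R_CompleteNormedModule) bd a b0 b1) by auto.
    unfold plus; simpl AbelianMonoid.plus.
    rewrite Rmult_plus_distr_l.
    eapply Rle_trans; [|apply Rplus_le_compat; [exact IHQ|exact H]].
    eapply Rle_trans; [|apply Cmod_triangle]. right. f_equal. ring.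
Qed.

(** The weight lies between 0 and 1, so the two integrals cost their lengths, 2 e and e. *)
Lemma sideV_bound (s : R) : Cmod (sideV F h e s) <= 3 * e * B * bd s.
Proof.
  unfold sideV. rewrite Cmod_mult, Cmod_Ci, Rmult_1_l.
  eapply Rle_trans; [apply Cmod_sum_le|].
  replace (3 * e * B * bd s) with ((e - - e) * (B * bd s) + (0 - - e) * (B * bd s)) by ring.
  apply Rplus_le_compat; apply CI_norm_const; try lra.
  - intros y Hy. rewrite Cmod_mult, Cmod_R.
    assert (P := exp_pos (2 * PI / h * y)).
    assert (P1 : 0 < / (1 + exp (2 * PI / h * y))) by (apply Rinv_0_lt_compat; lra).
    assert (P2 : / (1 + exp (2 * PI / h * y)) <= 1).
    { rewrite <- Rinv_1 at 2. apply Rinv_le_contravar; lra. }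
    rewrite Rabs_pos_eq by lra. rewrite <- (Rmult_1_r (B * bd s)).
    apply Rmult_le_compat; [apply Cmod_ge_0|lra|apply HFB; lra|lra].
  - apply CIex_cont. rewrite Rmin_left, Rmax_right by lra. intros y Hy.
    destruct (rcont_v F s y (HFc s y Hy)) as [R1 R2].
    assert (CK : continuous (fun t => / (1 + exp (2 * PI / h * t))) y).
    { apply (ex_derive_continuous (fun t => / (1 + exp (2 * PI / h * t)))).
      auto_derive. assert (P := exp_pos (2 * PI / h * y)). lra. }
    split.
    + apply (continuous_ext (fun t => mult (Re (F (s, t))) (/ (1 + exp (2 * PI / h * t))))).
      { intros t. unfold mult, Re; simpl. ring. }
      apply (continuous_mult (fun t => Re (F (s, t))) (fun t => / (1 + exp (2 * PI / h * t)))); auto.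
    + apply (continuous_ext (fun t => mult (Im (F (s, t))) (/ (1 + exp (2 * PI / h * t))))).
      { intros t. unfold mult, Im; simpl. ring. }
      apply (continuous_mult (fun t => Im (F (s, t))) (fun t => / (1 + exp (2 * PI / h * t)))); auto.
  - intros y Hy. apply HFB; lra.
  - apply CIex_v; [lra|]. intros; apply HFc; lra.
Qed.

(** The 4 is the 2 for the two horizontal lines times the 2 in the integral bound 2 / mu; the last
    term comes from the two outermost vertical sides, 3 e each. *)
Lemma trapezoid_error (L : nat) :
  let X := (INR L + 1 / 2) * h in
  Cmod (RtoC h * sum_MN L L (fun k => F (RtoC (IZR k * h))) - CI (fun x => F (x, 0)) (- X) X)%C
  <= 4 * B * q / mu + 6 * e * B * exp (- mu * X).
Proof.
  cbv zeta. assert (H := cells_error L L). cbv zeta in H.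
  assert (PL := pos_INR L).
  set (X := (INR L + 1 / 2) * h) in *.
  assert (PX : 0 < X) by (unfold X; apply Rmult_lt_0_compat; lra).
  assert (V1 := sideV_bound X). assert (V2 := sideV_bound (- X)).
  unfold bd in V1, V2. rewrite Rabs_Ropp in V2. rewrite Rabs_pos_eq in V1, V2 by lra.
  assert (Pq : 0 <= q).
  { unfold q. left. apply Rinv_0_lt_compat.
    assert (PW : 0 < 2 * PI / h * e).
    { apply Rmult_lt_0_compat; auto. apply Rdiv_lt_0_compat; auto. assert (T := PI_RGT_0). lra. }
    assert (T := exp_ineq1 _ ltac:(apply Rgt_not_eq; exact PW)). lra. }
  assert (BI := RInt_exp_abs_le mu (-X) X Hmu ltac:(lra)).
  set (S := (RtoC h * sum_MN L L (fun k : Z => F (RtoC (IZR k * h))))%C) in *.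
  set (J := CI (fun x : R => F (x, 0)) (- X) X) in *.
  set (W := (sideV F h e X - sideV F h e (- X))%C) in *.
  assert (W1 : Cmod W <= 6 * e * B * exp (- mu * X)).
  { unfold W. eapply Rle_trans; [apply Cmod_sum_le|]. lra. }
  replace (S - J)%C with ((S - J - W) + W)%C by ring.
  eapply Rle_trans; [apply Cmod_triangle|].
  apply Rplus_le_compat; auto.
  eapply Rle_trans; [apply H|].
  replace (4 * B * q / mu) with (2 * B * q * (2 / mu)) by (field; lra).
  apply Rmult_le_compat_l; auto. repeat apply Rmult_le_pos; lra.
Qed.

End Trapezoid.

(** * Truncation, limits and the substitution t = sinh x *)

Lemma exp_le (x y : R) : x <= y -> exp x <= exp y.
Proof. intros [H| ->]; [left; apply exp_increasing, H|lra]. Qed.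

(** The right-hand side is the integral of e^(-c x) over a step that ends at the sampled point; the
    comparison reduces to 1 + c h <= e^(c h). These integrals telescope, so summing them produces 1
    / c and no denominator 1 - e^(-c h). *)
Lemma exp_decay_step (c h : R) (j : nat) : 0 < c ->
  h * exp (- c * (INR (S j) * h)) <= (exp (- c * (INR j * h)) - exp (- c * (INR (S j) * h))) / c.
Proof.
  intros Hc. rewrite S_INR.
  replace (- c * (INR j * h)) with (c * h + - c * ((INR j + 1) * h)) by ring.
  rewrite exp_plus. set (E := exp (- c * ((INR j + 1) * h))).
  assert (PE : 0 < E) by apply exp_pos.
  assert (X := exp_ineq1_le (c * h)).
  apply Rmult_le_reg_r with c; auto.
  replace ((exp (c * h) * E - E) / c * c) with (exp (c * h) * E - E) by (field; lra).
  assert (E * (1 + c * h) <= E * exp (c * h)) by (apply Rmult_le_compat_l; lra). lra.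
Qed.

Lemma tail_bound (g : Z -> C) (h A al be : R) (M N a b : nat) :
  0 < h -> 0 < al -> 0 < be -> 0 <= A ->
  (forall j : nat, Cmod (g (Z.of_nat j)) <= A * exp (- be * (INR j * h))) ->
  (forall j : nat, Cmod (g (- Z.of_nat (S j))%Z) <= A * exp (- al * (INR (S j) * h))) ->
  Cmod (RtoC h * sum_MN (M + a) (N + b) g - RtoC h * sum_MN M N g)%C
  <= A * (exp (- al * (INR M * h)) / al + exp (- be * (INR N * h)) / be).
Proof.
  intros Hh Hal Hbe HA Hr Hl.
  (* The exponential at the far end is carried along because the induction telescopes through it; it
     is dropped only at the end. *)
  assert (R1 : forall b, Cmod (RtoC h * sum_MN M (N + b) g - RtoC h * sum_MN M N g)%C
    <= A * ((exp (- be * (INR N * h)) - exp (- be * (INR (N + b) * h))) / be)).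
  { induction b0 as [|k IH].
    - rewrite Nat.add_0_r.
      replace (RtoC h * sum_MN M N g - RtoC h * sum_MN M N g)%C with (RtoC 0) by ring.
      rewrite Cmod_0. replace (_ - _) with 0 by ring. lra.
    - rewrite Nat.add_succ_r, sum_MN_S_r.
      replace (RtoC h * (sum_MN M (N + k) g + g (Z.of_nat (S (N + k)))) - RtoC h * sum_MN M N g)%C
        with ((RtoC h * sum_MN M (N + k) g - RtoC h * sum_MN M N g) + RtoC h * g (Z.of_nat (S (N + k))))%C by ring.
      eapply Rle_trans; [apply Cmod_triangle|]. rewrite Cmod_mult, Cmod_R, Rabs_pos_eq by lra.
      assert (S1 := exp_decay_step be h (N + k) Hbe).
      assert (S2 := Hr (S (N + k))).
      apply Rmult_le_compat_l with (r := h) in S2; [|lra].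
      apply Rmult_le_compat_l with (r := A) in S1; [|lra].
      unfold Rdiv in *. lra. }
  assert (L1 : forall N a, Cmod (RtoC h * sum_MN (M + a) N g - RtoC h * sum_MN M N g)%C
    <= A * ((exp (- al * (INR M * h)) - exp (- al * (INR (M + a) * h))) / al)).
  { intros N0. induction a0 as [|k IH].
    - rewrite Nat.add_0_r.
      replace (RtoC h * sum_MN M N0 g - RtoC h * sum_MN M N0 g)%C with (RtoC 0) by ring.
      rewrite Cmod_0. replace (_ - _) with 0 by ring. lra.
    - rewrite Nat.add_succ_r, sum_MN_S_l.
      replace (RtoC h * (sum_MN (M + k) N0 g + g (- Z.of_nat (S (M + k)))%Z) - RtoC h * sum_MN M N0 g)%C
        with ((RtoC h * sum_MN (M + k) N0 g - RtoC h * sum_MN M N0 g) + RtoC h * g (- Z.of_nat (S (M + k)))%Z)%C by ring.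
      eapply Rle_trans; [apply Cmod_triangle|]. rewrite Cmod_mult, Cmod_R, Rabs_pos_eq by lra.
      assert (S1 := exp_decay_step al h (M + k) Hal).
      assert (S2 := Hl (M + k)%nat).
      apply Rmult_le_compat_l with (r := h) in S2; [|lra].
      apply Rmult_le_compat_l with (r := A) in S1; [|lra].
      unfold Rdiv in *. lra. }
  replace (RtoC h * sum_MN (M + a) (N + b) g - RtoC h * sum_MN M N g)%C
    with ((RtoC h * sum_MN (M + a) (N + b) g - RtoC h * sum_MN M (N + b) g)
          + (RtoC h * sum_MN M (N + b) g - RtoC h * sum_MN M N g))%C by ring.
  eapply Rle_trans; [apply Cmod_triangle|].
  specialize (R1 b). specialize (L1 (N + b)%nat a).
  assert (P1 := exp_pos (- be * (INR (N + b) * h))).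
  assert (P2 := exp_pos (- al * (INR (M + a) * h))).
  assert (Q1 : 0 < / be) by (apply Rinv_0_lt_compat; auto).
  assert (Q2 : 0 < / al) by (apply Rinv_0_lt_compat; auto).
  unfold Rdiv in *.
  assert (T1 : A * ((exp (- be * (INR N * h)) - exp (- be * (INR (N + b) * h))) * / be)
    <= A * (exp (- be * (INR N * h)) * / be)) by (apply Rmult_le_compat_l; [lra|apply Rmult_le_compat_r; lra]).
  assert (T2 : A * ((exp (- al * (INR M * h)) - exp (- al * (INR (M + a) * h))) * / al)
    <= A * (exp (- al * (INR M * h)) * / al)) by (apply Rmult_le_compat_l; [lra|apply Rmult_le_compat_r; lra]).
  lra.
Qed.

Lemma exp_decay_small (C0 c eps : R) : 0 <= C0 -> 0 < c -> 0 < eps ->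
  exists X, 0 < X /\ forall x, X <= x -> C0 * exp (- c * x) < eps.
Proof.
  intros HC Hc He. exists ((C0 + 1) / (c * eps)).
  assert (P0 : 0 < (C0 + 1) / (c * eps)) by (apply Rdiv_lt_0_compat; [lra|apply Rmult_lt_0_compat; lra]).
  split; auto. intros x Hx.
  replace (- c * x) with (- (c * x)) by ring. rewrite exp_Ropp.
  assert (Px : 0 < c * x) by (apply Rmult_lt_0_compat; lra).
  assert (T := exp_ineq1_le (c * x)).
  apply Rmult_lt_reg_r with (exp (c * x)); [apply exp_pos|].
  rewrite Rmult_assoc, Rinv_l by (apply Rgt_not_eq, exp_pos).
  assert (A1 : C0 + 1 <= eps * (c * x)).
  { apply Rmult_le_compat_l with (r := c * eps) in Hx; [|left; apply Rmult_lt_0_compat; lra].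
    replace (c * eps * ((C0 + 1) / (c * eps))) with (C0 + 1) in Hx by (field; lra). lra. }
  assert (A2 : eps * (c * x) <= eps * exp (c * x)) by (apply Rmult_le_compat_l; lra). lra.
Qed.

Lemma CI_tail (phi : R -> C) (B mu a b : R) : 0 <= B -> 0 < mu -> 0 <= a <= b ->
  (forall s t, CIex phi s t) ->
  (forall x, Cmod (phi x) <= B * exp (- mu * Rabs x)) ->
  Cmod (CI phi a b) <= B / mu * exp (- mu * a) /\
  Cmod (CI phi (- b) (- a)) <= B / mu * exp (- mu * a).
Proof.
  intros HB Hmu Hab Hex Hb.
  assert (Pb := exp_pos (- mu * b)).
  assert (PQ : 0 <= B / mu) by (apply Rmult_le_pos; [lra|left; apply Rinv_0_lt_compat; auto]).
  assert (PP : 0 <= B / mu * exp (- mu * b)) by (apply Rmult_le_pos; lra).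
  split.
  - assert (I : is_RInt (fun x => B * exp (- mu * x)) a b (B * (exp (- mu * b) / - mu - exp (- mu * a) / - mu)))
      by exact (is_RInt_scal (V := R_NormedModule) _ _ _ B _ (is_RInt_exp_lin (- mu) a b ltac:(lra))).
    eapply Rle_trans; [apply (CI_norm phi (fun x => B * exp (- mu * x))); try lra; auto|].
    + intros x Hx. rewrite <- (Rabs_pos_eq x) at 2 by lra. apply Hb.
    + eexists; exact I.
    + rewrite (is_RInt_unique _ _ _ _ I).
      replace (B * (exp (- mu * b) / - mu - exp (- mu * a) / - mu))
        with (B / mu * exp (- mu * a) - B / mu * exp (- mu * b)) by (field; lra). lra.
  - assert (I : is_RInt (fun x => B * exp (mu * x)) (- b) (- a) (B * (exp (mu * - a) / mu - exp (mu * - b) / mu)))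
      by exact (is_RInt_scal (V := R_NormedModule) _ _ _ B _ (is_RInt_exp_lin mu (- b) (- a) ltac:(lra))).
    eapply Rle_trans; [apply (CI_norm phi (fun x => B * exp (mu * x))); try lra; auto|].
    + intros x Hx. eapply Rle_trans; [apply Hb|]. rewrite Rabs_left1 by lra. right.
      f_equal. f_equal. ring.
    + eexists; exact I.
    + rewrite (is_RInt_unique _ _ _ _ I).
      replace (mu * - a) with (- mu * a) by ring. replace (mu * - b) with (- mu * b) by ring.
      replace (B * (exp (- mu * a) / mu - exp (- mu * b) / mu))
        with (B / mu * exp (- mu * a) - B / mu * exp (- mu * b)) by (field; lra). lra.
Qed.

(** The value arises as the limit of the integrals over [-n, n]. The explicit rate is used twice:
    for convergence of the original integral after the substitution, and for the comparison with
    finitely many cells. *)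
Lemma improper_CI (phi : R -> C) (B mu : R) : 0 <= B -> 0 < mu ->
  (forall s t, CIex phi s t) ->
  (forall x, Cmod (phi x) <= B * exp (- mu * Rabs x)) ->
  exists I : C, forall a b, 0 <= a -> 0 <= b ->
    Cmod (I - CI phi (- a) b) <= B / mu * (exp (- mu * a) + exp (- mu * b)).
Proof.
  intros HB Hmu Hex Hb.
  assert (PQ : 0 <= B / mu) by (apply Rmult_le_pos; [lra|left; apply Rinv_0_lt_compat; auto]).
  (* Enlarging the interval adds one tail on each side. This gives the Cauchy property and, in the
     limit, the rate. *)
  assert (D : forall a b a' b', 0 <= a <= a' -> 0 <= b <= b' ->
    Cmod (CI phi (- a') b' - CI phi (- a) b) <= B / mu * (exp (- mu * a) + exp (- mu * b))).
  { intros a b a' b' Ha Hb'.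
    rewrite <- (CI_Chasles phi (- a') (- a) b') by auto.
    rewrite <- (CI_Chasles phi (- a) b b') by auto.
    replace (CI phi (- a') (- a) + (CI phi (- a) b + CI phi b b') - CI phi (- a) b)%C
      with (CI phi (- a') (- a) + CI phi b b')%C by ring.
    eapply Rle_trans; [apply Cmod_triangle|].
    destruct (CI_tail phi B mu a a') as [_ T1]; auto.
    destruct (CI_tail phi B mu b b') as [T2 _]; auto. lra. }
  set (J := fun n : nat => CI phi (- INR n) (INR n)).
  assert (CJ : forall eps, 0 < eps -> exists N, forall n m, (N <= n)%nat -> (N <= m)%nat -> Cmod (J n - J m) < eps).
  { intros eps He. destruct (exp_decay_small (B / mu * 2) mu (eps / 2)) as [X [PX HX]]; try lra.
    destruct (nfloor_ex X ltac:(lra)) as [N0 [_ HN]]. exists (S N0).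
    assert (Q : forall n m, (S N0 <= n)%nat -> (n <= m)%nat -> Cmod (J m - J n) < eps / 2).
    { intros n m Hn Hm. apply le_INR in Hn, Hm. rewrite S_INR in Hn. assert (PN := pos_INR n).
      eapply Rle_lt_trans; [apply D; lra|]. specialize (HX (INR n) ltac:(lra)). lra. }
    intros n m Hn Hm. destruct (Nat.le_ge_cases n m) as [L|L].
    - replace (J n - J m)%C with (- (J m - J n))%C by ring. rewrite Cmod_opp.
      specialize (Q n m Hn L). lra.
    - specialize (Q m n Hm L). lra. }
  destruct (Rcomplete.R_complete (fun n => Re (J n))) as [l1 H1].
  { intros eps He. destruct (CJ eps He) as [N HN]. exists N. intros n m Hn Hm.
    unfold Rdist. eapply Rle_lt_trans; [apply (re_le_Cmod (J n - J m))|]. apply HN; auto. }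
  destruct (Rcomplete.R_complete (fun n => Im (J n))) as [l2 H2].
  { intros eps He. destruct (CJ eps He) as [N HN]. exists N. intros n m Hn Hm.
    unfold Rdist. eapply Rle_lt_trans; [apply (Im_le_Cmod (J n - J m))|]. apply HN; auto. }
  exists (l1, l2). intros a b Ha Hb'. apply le_epsilon. intros eps He.
  destruct (H1 (eps / 2) ltac:(lra)) as [N1 K1]. destruct (H2 (eps / 2) ltac:(lra)) as [N2 K2].
  destruct (nfloor_ex a Ha) as [Na [_ HNa]]. destruct (nfloor_ex b Hb') as [Nb [_ HNb]].
  set (n := (N1 + N2 + S Na + S Nb)%nat).
  specialize (K1 n ltac:(unfold n; lia)). specialize (K2 n ltac:(unfold n; lia)).
  assert (Bn : INR Na + 1 <= INR n /\ INR Nb + 1 <= INR n).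
  { rewrite <- !S_INR. split; apply le_INR; unfold n; lia. }
  replace ((l1, l2) - CI phi (- a) b)%C with ((J n - CI phi (- a) b) + ((l1, l2) - J n))%C by ring.
  eapply Rle_trans; [apply Cmod_triangle|]. apply Rplus_le_compat.
  - unfold J. apply D; lra.
  - destruct (J n) as [j1 j2]. unfold Re, Im in K1, K2; simpl in K1, K2. unfold Rdist in *.
    replace ((l1, l2) - (j1, j2))%C with ((l1 - j1, l2 - j2) : C) by cring.
    eapply Rle_trans; [apply Cmod_pair_le|].
    rewrite (Rabs_minus_sym l1), (Rabs_minus_sym l2). lra.
Qed.

(** * Complex hyperbolic functions and the substitution *)

Definition ccosh (z : C) : C :=
  (cosh (fst z) * cos (snd z), sinh (fst z) * sin (snd z)).

Lemma cdiff_ext (f g : C -> C) (z : C) : (forall u, f u = g u) -> cdiff f z -> cdiff g z.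
Proof.
  intros H [p [Hp [d [Hd K]]]]. exists p; split; auto. exists d; split; auto.
  intros u Hu. rewrite <- !H. auto.
Qed.

Lemma cdiff_cexp_opp (z : C) : cdiff (fun u => cexp (- (1) * u)%C) z.
Proof.
  apply (cdiff_comp cexp (fun u => - (1) * u)%C); [|apply cdiff_cexp].
  apply cdiff_mult; [apply cdiff_const|apply cdiff_id].
Qed.

Lemma cdiff_csinh (z : C) : cdiff csinh z.
Proof.
  apply cdiff_ext with (fun u => RtoC (1/2) * (cexp u + - (1) * cexp (- (1) * u)))%C.
  - intros [x y]. unfold cexp, csinh, sinh, cosh. simpl.
    replace (- (1) * x - - 0 * y) with (- x) by ring.
    replace (- (1) * y + - 0 * x) with (- y) by ring.
    rewrite cos_neg, sin_neg. apply Ceq_ext; unfold Re, Im; simpl; field.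
  - apply cdiff_mult; [apply cdiff_const|]. apply cdiff_plus; [apply cdiff_cexp|].
    apply cdiff_mult; [apply cdiff_const|apply cdiff_cexp_opp].
Qed.

Lemma cdiff_ccosh (z : C) : cdiff ccosh z.
Proof.
  apply cdiff_ext with (fun u => RtoC (1/2) * (cexp u + cexp (- (1) * u)))%C.
  - intros [x y]. unfold cexp, ccosh, sinh, cosh. simpl.
    replace (- (1) * x - - 0 * y) with (- x) by ring.
    replace (- (1) * y + - 0 * x) with (- y) by ring.
    rewrite cos_neg, sin_neg. apply Ceq_ext; unfold Re, Im; simpl; field.
  - apply cdiff_mult; [apply cdiff_const|]. apply cdiff_plus; [apply cdiff_cexp|apply cdiff_cexp_opp].
Qed.

Lemma cosh2_sinh2 (x : R) : cosh x * cosh x = 1 + sinh x * sinh x.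
Proof.
  unfold cosh, sinh. assert (H : exp x * exp (- x) = 1) by (rewrite <- exp_plus, Rplus_opp_r; apply exp_0).
  field_simplify. nra.
Qed.

(** Turns the assumed power of |1 + z^2| into a power of |cosh|^2, of which the factor cosh from the
    substitution absorbs one power of |cosh|. *)
Lemma one_plus_csinh2 (z : C) : (1 + csinh z * csinh z = ccosh z * ccosh z)%C.
Proof.
  destruct z as [x y]. assert (H := cosh2_sinh2 x). assert (T := sin2_cos2 y). unfold Rsqr in T.
  apply Ceq_ext; unfold Re, Im; simpl.
  - transitivity ((1 + sinh x * sinh x) * (cos y * cos y) - sinh x * sinh x * (sin y * sin y)); [|rewrite <- H; ring].
    transitivity ((sin y * sin y + cos y * cos y) + sinh x * sinh x * (cos y * cos y) - cosh x * cosh x * (sin y * sin y)); [rewrite T; ring|].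
    rewrite H; ring.
  - ring.
Qed.

(** The real part cosh x cos y alone is already this large. *)
Lemma Cmod_ccosh_lower (x y c : R) : 0 < c <= cos y -> exp (Rabs x) / 2 * c <= Cmod (ccosh (x, y)).
Proof.
  intros Hc. eapply Rle_trans; [|apply re_le_Cmod]. unfold ccosh, Re; simpl.
  assert (P1 := exp_pos x). assert (P2 := exp_pos (- x)).
  assert (E : exp (Rabs x) / 2 <= cosh x).
  { unfold cosh, Rabs. destruct (Rcase_abs x); lra. }
  assert (P3 := exp_pos (Rabs x)).
  rewrite (Rabs_pos_eq (cosh x * cos y)) by (apply Rmult_le_pos; lra).
  apply Rmult_le_compat; lra.
Qed.

(** With r standing for |cosh z|, the left-hand side is r^(-g), and the bound is the lower estimate
    of r raised to the power -g. Logarithms make this inequality linear. *)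
Lemma decay_bound (g r x c : R) : 0 < g -> 0 < c -> exp (Rabs x) / 2 * c <= r ->
  Rpower (r * r) (- (g + 1) / 2) * r <= Rpower 2 g * / Rpower c g * exp (- g * Rabs x).
Proof.
  intros Hg Hc Hr. assert (PE := exp_pos (Rabs x)).
  assert (P0 : 0 < exp (Rabs x) / 2 * c) by (apply Rmult_lt_0_compat; lra).
  assert (Pr : 0 < r) by lra.
  assert (L : Rabs x - ln 2 + ln c <= ln r).
  { replace (Rabs x - ln 2 + ln c) with (ln (exp (Rabs x) / 2 * c)).
    - destruct Hr as [Hr|Hr]; [left; apply ln_increasing; auto|rewrite Hr; lra].
    - rewrite ln_mult, ln_div, ln_exp; lra. }
  unfold Rpower. rewrite ln_mult by auto. rewrite <- exp_Ropp.
  rewrite <- (exp_ln r) at 3 by auto. rewrite <- !exp_plus.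
  replace (- (g + 1) / 2 * (ln r + ln r) + ln r) with (- (g * ln r)) by field.
  assert (G : g * (Rabs x - ln 2 + ln c) <= g * ln r) by (apply Rmult_le_compat_l; lra).
  destruct (Rle_lt_or_eq_dec (- (g * ln r)) (g * ln 2 + - (g * ln c) + - g * Rabs x)) as [Q|Q]; [lra| |].
  - left; apply exp_increasing; auto.
  - rewrite Q; lra.
Qed.

Lemma CI_sinh_subst (f : C -> C) (a b : R) :
  (forall t, ccont f (RtoC t)) ->
  is_RInt (fun t => f (RtoC t)) (sinh a) (sinh b) (CI (fun x => f (RtoC (sinh x)) * RtoC (cosh x))%C a b).
Proof.
  intros Hf.
  assert (RC : forall t, rcont (fun t => f (RtoC t)) t) by (intros t; apply rcont_h; apply Hf).
  assert (E : CI (fun x => f (RtoC (sinh x)) * RtoC (cosh x))%C a b = CI (fun t => f (RtoC t)) (sinh a) (sinh b)).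
  { assert (DS : forall x, is_derive sinh x (cosh x) /\ continuous cosh x).
    { intros x. split; [apply is_derive_Reals, derivable_pt_lim_sinh|].
      apply continuity_pt_filterlim. apply derivable_continuous_pt. exists (sinh x). apply derivable_pt_lim_cosh. }
    unfold CI. f_equal.
    - rewrite <- (RInt_comp (V := R_CompleteNormedModule) (fun t => Re (f (RtoC t))) sinh cosh); auto.
      + apply RInt_ext. intros x _. unfold scal; simpl; unfold mult, Re; simpl. ring.
      + intros x _. apply RC.
    - rewrite <- (RInt_comp (V := R_CompleteNormedModule) (fun t => Im (f (RtoC t))) sinh cosh); auto.
      + apply RInt_ext. intros x _. unfold scal; simpl; unfold mult, Im; simpl. ring.
      + intros x _. apply RC. }
  rewrite E. apply CI_is. apply CIex_cont. auto.
Qed.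

(** Arbitrary endpoints are pulled back by arcsinh, so the rate in the variable x yields convergence
    in t = sinh x, with both endpoints tending to infinity independently. *)
Lemma is_RInt_gen_sinh (f : C -> C) (B mu : R) (I : C) : 0 <= B -> 0 < mu ->
  (forall t, ccont f (RtoC t)) ->
  (forall a b, 0 <= a -> 0 <= b ->
    Cmod (I - CI (fun x => f (RtoC (sinh x)) * RtoC (cosh x))%C (- a) b)
    <= B / mu * (exp (- mu * a) + exp (- mu * b))) ->
  is_RInt_gen (fun t : R => f (RtoC t)) (Rbar_locally m_infty) (Rbar_locally p_infty) I.
Proof.
  intros HB Hmu Hf HI P [eps HP].
  assert (PQ : 0 <= B / mu) by (apply Rmult_le_pos; [lra|left; apply Rinv_0_lt_compat; auto]).
  destruct (exp_decay_small (B / mu * 2) mu eps) as [X [PX HX]]; [lra|auto|apply cond_pos|].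
  unfold filtermapi. apply Filter_prod with (fun t => t < sinh (- X)) (fun t => sinh X < t).
  - exists (sinh (- X)). auto.
  - exists (sinh X). auto.
  - intros s t Hs Ht. simpl.
    exists (CI (fun x => f (RtoC (sinh x)) * RtoC (cosh x))%C (arcsinh s) (arcsinh t)). split.
    + rewrite <- (sinh_arcsinh s) at 1. rewrite <- (sinh_arcsinh t) at 1. apply CI_sinh_subst; auto.
    + apply HP.
      apply arcsinh_lt in Hs, Ht. rewrite arcsinh_sinh in Hs, Ht.
      specialize (HI (- arcsinh s) (arcsinh t) ltac:(lra) ltac:(lra)).
      rewrite Ropp_involutive in HI.
      set (J := CI _ (arcsinh s) (arcsinh t)) in *.
      assert (H1 := HX (- arcsinh s) ltac:(lra)). assert (H2 := HX (arcsinh t) ltac:(lra)).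
      assert (H3 : Cmod (J - I) < eps).
      { replace (J - I)%C with (- (I - J))%C by ring. rewrite Cmod_opp. lra. }
      split.
      * eapply Rle_lt_trans; [apply (re_le_Cmod (J - I))|exact H3].
      * eapply Rle_lt_trans; [apply (Im_le_Cmod (J - I))|exact H3].
Qed.

(** [up (- x) - 1] is the floor of -x, so [Rceil] is indeed the ceiling. *)
Lemma Rceil_ge (x : R) : 0 <= x -> x <= INR (Z.to_nat (Rceil x)).
Proof.
  intros Hx. destruct (archimed (- x)) as [A1 A2].
  assert (H : x <= IZR (Rceil x)).
  { unfold Rceil. rewrite opp_IZR, minus_IZR. lra. }
  rewrite INR_IZR_INZ, Z2Nat.id; auto. apply le_IZR. lra.
Qed.

(** The purpose of the two truncation indices: each tail decays at least like e^(-mu n h). The side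
    with the larger exponent gets the shorter sum, rounded up so as to stay on the safe side. *)
Lemma trunc_spec (alpha beta : R) (n : nat) : 0 < alpha -> 0 < beta ->
  Rmin alpha beta * INR n <= alpha * INR (trunc_M alpha beta n) /\
  Rmin alpha beta * INR n <= beta * INR (trunc_N alpha beta n).
Proof.
  intros Ha Hb. assert (Pn := pos_INR n). unfold trunc_M, trunc_N.
  destruct (Rle_dec alpha beta) as [L|L].
  - rewrite Rmin_left by auto. split; [lra|].
    assert (H := Rceil_ge (alpha * INR n / beta)).
    replace (alpha * INR n) with (beta * (alpha * INR n / beta)) at 1 by (field; lra).
    apply Rmult_le_compat_l; [lra|]. apply H. apply Rmult_le_pos; [apply Rmult_le_pos; lra|left; apply Rinv_0_lt_compat; auto].
  - rewrite Rmin_right by lra. split; [|lra].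
    assert (H := Rceil_ge (beta * INR n / alpha)).
    replace (beta * INR n) with (alpha * (beta * INR n / alpha)) at 1 by (field; lra).
    apply Rmult_le_compat_l; [lra|]. apply H. apply Rmult_le_pos; [apply Rmult_le_pos; lra|left; apply Rinv_0_lt_compat; auto].
Qed.

(** For A > 0 the inequality at e is equivalent to w e <= ln (D / A + 1). If it failed at d, it
    would also fail at the midpoint between ln (D / A + 1) / w and d, which is below d. *)
Lemma le_inv_exp_limit (A D w d : R) : 0 < w -> 0 < d -> 0 < D ->
  (forall e, 0 < e < d -> A <= D * / (exp (w * e) - 1)) -> A <= D * / (exp (w * d) - 1).
Proof.
  intros Hw Hd HD H.
  assert (PE : forall e, 0 < e -> 0 < exp (w * e) - 1).
  { intros e He. assert (0 < w * e) by (apply Rmult_lt_0_compat; auto).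
    assert (T := exp_ineq1_le (w * e)). lra. }
  apply Rnot_lt_le. intros N.
  assert (PA : 0 < A).
  { eapply Rle_lt_trans; [|apply N]. left. apply Rmult_lt_0_compat; auto.
    apply Rinv_0_lt_compat; auto. }
  set (Z := D / A + 1).
  assert (PZ : 0 < D / A) by (apply Rdiv_lt_0_compat; auto).
  assert (HZ : forall e, 0 < e < d -> w * e <= ln Z).
  { intros e He. specialize (H e He). specialize (PE e ltac:(lra)).
    apply Rmult_le_compat_r with (r := exp (w * e) - 1) in H; [|lra].
    rewrite Rmult_assoc, Rinv_l, Rmult_1_r in H by lra.
    apply Rmult_le_compat_l with (r := / A) in H; [|left; apply Rinv_0_lt_compat; auto].
    rewrite <- Rmult_assoc, Rinv_l, Rmult_1_l in H by lra.
    rewrite <- (ln_exp (w * e)). apply ln_le; [apply exp_pos|]. unfold Z, Rdiv. lra. }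
  assert (LZ : ln Z < w * d).
  { rewrite <- (ln_exp (w * d)). apply ln_increasing; [unfold Z; lra|].
    specialize (PE d Hd).
    apply Rmult_lt_compat_r with (r := exp (w * d) - 1) in N; [|lra].
    rewrite Rmult_assoc, Rinv_l, Rmult_1_r in N by lra.
    apply Rmult_lt_compat_l with (r := / A) in N; [|apply Rinv_0_lt_compat; auto].
    rewrite <- Rmult_assoc, Rinv_l, Rmult_1_l in N by lra. unfold Z, Rdiv. lra. }
  assert (L2 : ln Z / w < d).
  { apply Rmult_lt_reg_r with w; auto. unfold Rdiv. rewrite Rmult_assoc, Rinv_l by lra. lra. }
  assert (L3 := HZ (d / 2) ltac:(lra)).
  assert (L4 : 0 < ln Z / w).
  { apply Rdiv_lt_0_compat; auto. assert (0 < w * (d / 2)) by (apply Rmult_lt_0_compat; lra). lra. }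
  specialize (HZ ((ln Z / w + d) / 2) ltac:(lra)).
  assert (Q : w * (ln Z / w) < w * ((ln Z / w + d) / 2)) by (apply Rmult_lt_compat_l; lra).
  replace (w * (ln Z / w)) with (ln Z) in Q by (field; lra). lra.
Qed.

(** * The error bound *)

Lemma csinh_real (x : R) : csinh (x, 0) = RtoC (sinh x).
Proof. unfold csinh; simpl. rewrite cos_0, sin_0. cring. Qed.

Lemma ccosh_real (x : R) : ccosh (x, 0) = RtoC (cosh x).
Proof. unfold ccosh; simpl. rewrite cos_0, sin_0. cring. Qed.

Lemma cos_abs_ge (d y : R) : d < PI / 2 -> Rabs y <= d -> cos d <= cos y.
Proof.
  intros Hd Hy. assert (Pp := PI_RGT_0). assert (P0 := Rabs_pos y).
  replace (cos y) with (cos (Rabs y)).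
  - apply cos_decr_1; lra.
  - unfold Rabs; destruct (Rcase_abs y); auto. apply cos_neg.
Qed.

(** The lower bound [c] for the cosine is left free because it is used with two values: cos d on the
    whole strip, and 1 at the real nodes. *)
Lemma pullback_bound (f : C -> C) (z : C) (K g c : R) : 0 < K -> 0 < g -> 0 < c <= cos (Im z) ->
  Cmod (f (csinh z)) <= K * Rpower (Cmod (1 + csinh z * csinh z)%C) (- (g + 1) / 2) ->
  Cmod (f (csinh z) * ccosh z)%C <= K * (Rpower 2 g * / Rpower c g * exp (- g * Rabs (Re z))).
Proof.
  intros HK Hg Hc H. rewrite one_plus_csinh2, Cmod_mult in H.
  destruct z as [x y]. unfold Re, Im in *; simpl in Hc |- *.
  assert (L := Cmod_ccosh_lower x y c Hc).
  rewrite Cmod_mult. set (r := Cmod (ccosh (x, y))) in *.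
  assert (Dd := decay_bound g r x c Hg ltac:(lra) L).
  eapply Rle_trans; [apply Rmult_le_compat_r; [apply Cmod_ge_0|exact H]|].
  fold r. rewrite Rmult_assoc. apply Rmult_le_compat_l; lra.
Qed.

Theorem theorem3 (d : R) (f : C -> C) (K alpha beta : R) (n : nat) :
  0 < d -> d < PI / 2 ->
  analytic_on_sinh_strip d f ->
  0 < K -> 0 < alpha -> 0 < beta ->
  (forall zeta : C, strip_minus d zeta ->
     Cmod (f (csinh zeta)) <=
     K * Rpower (Cmod (1 + csinh zeta * csinh zeta)%C) (- (alpha + 1) / 2)) ->
  (forall zeta : C, strip_plus d zeta ->
     Cmod (f (csinh zeta)) <=
     K * Rpower (Cmod (1 + csinh zeta * csinh zeta)%C) (- (beta + 1) / 2)) ->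
  (0 < n)%nat ->
  let mu := Rmin alpha beta in
  let nu := Rmax alpha beta in
  let h := sqrt (2 * PI * d / (mu * INR n)) in
  let M := trunc_M alpha beta n in
  let N := trunc_N alpha beta n in
  let C1 := Rpower 2 (nu + 1) * K / mu *
            (2 / ((1 - exp (- sqrt (2 * PI * d * mu))) * Rpower (cos d) nu) + 1) in
  exists I : C,
    is_RInt_gen (fun t : R => f (RtoC t))
      (Rbar_locally m_infty) (Rbar_locally p_infty) I /\
    Cmod (I - RtoC h *
          sum_MN M N (fun k : Z =>
             f (RtoC (sinh (IZR k * h))) * RtoC (cosh (IZR k * h))))%C
    <= C1 * exp (- sqrt (2 * PI * d * mu * INR n)).
Proof.
  intros Hd Hd2 Hana HK Hal Hbe Hminus Hplus Hn mu nu h M N C1.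
  assert (Pp := PI_RGT_0).
  assert (Pn : 1 <= INR n) by (apply (le_INR 1); lia).
  assert (Pmu : 0 < mu) by (apply Rmin_glb_lt; auto).
  assert (Mu1 : mu <= alpha) by apply Rmin_l. assert (Mu2 : mu <= beta) by apply Rmin_r.
  assert (Nu1 : alpha <= nu) by apply Rmax_l. assert (Nu2 : beta <= nu) by apply Rmax_r.
  assert (Pc : 0 < cos d) by (apply cos_gt_0; lra).
  assert (Pc1 := COS_bound d).
  assert (Pmn : 0 < mu * INR n) by (apply Rmult_lt_0_compat; lra).
  assert (Ph : 0 < h).
  { apply sqrt_lt_R0. apply Rdiv_lt_0_compat; auto. apply Rmult_lt_0_compat; lra. }
  set (s := sqrt (2 * PI * d * mu * INR n)).
  assert (Hhh : h * h = 2 * PI * d / (mu * INR n)).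
  { apply sqrt_sqrt. left. apply Rdiv_lt_0_compat; auto. apply Rmult_lt_0_compat; lra. }
  assert (Es : mu * INR n * h = s).
  { unfold s, h. rewrite <- (sqrt_square (mu * INR n)) at 1 by lra.
    rewrite <- sqrt_mult_alt by nra. f_equal. field. lra. }
  assert (Es2 : 2 * PI / h * d = s).
  { rewrite <- Es. apply Rmult_eq_reg_r with h; [|lra].
    replace (2 * PI / h * d * h) with (2 * PI * d) by (field; lra).
    replace (mu * INR n * h * h) with (mu * INR n * (h * h)) by ring. rewrite Hhh. field. lra. }
  set (F := fun z : C => (f (csinh z) * ccosh z)%C).
  set (B := K * (Rpower 2 nu * / Rpower (cos d) nu)).
  assert (P2n : 0 < Rpower 2 nu) by apply exp_pos.
  assert (Pcn : 0 < Rpower (cos d) nu) by apply exp_pos.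
  assert (PB : 0 < B).
  { apply Rmult_lt_0_compat; auto. apply Rmult_lt_0_compat; auto. apply Rinv_0_lt_compat; auto. }
  assert (Fl : forall x y c, Rabs y < d -> x < 0 -> 0 < c <= cos y ->
    Cmod (F (x, y)) <= K * (Rpower 2 alpha * / Rpower c alpha * exp (- alpha * Rabs x))).
  { intros x y c Hy Hx Hc. apply (pullback_bound f (x, y)); auto.
    apply Hminus. split; [exact Hy|exact Hx]. }
  assert (Fr : forall x y c, Rabs y < d -> 0 <= x -> 0 < c <= cos y ->
    Cmod (F (x, y)) <= K * (Rpower 2 beta * / Rpower c beta * exp (- beta * Rabs x))).
  { intros x y c Hy Hx Hc. apply (pullback_bound f (x, y)); auto.
    apply Hplus. split; [exact Hy|exact Hx]. }
  assert (mono2 : forall g, g <= nu -> Rpower 2 g <= Rpower 2 nu).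
  { intros g Hg. apply Rle_Rpower; lra. }
  (* As 0 < cos d <= 1, the largest exponent gives the smallest power, hence the largest
     reciprocal. *)
  assert (monoc : forall g, g <= nu -> Rpower (cos d) nu <= Rpower (cos d) g).
  { intros g Hg. unfold Rpower. apply exp_le.
    assert (LC : ln (cos d) <= 0) by (rewrite <- ln_1; apply ln_le; lra). nra. }
  assert (FB : forall x y, Rabs y < d -> Cmod (F (x, y)) <= B * exp (- mu * Rabs x)).
  { intros x y Hy.
    assert (Cy : 0 < cos d <= cos y) by (split; auto; apply cos_abs_ge; lra).
    assert (W : forall g, mu <= g <= nu ->
      K * (Rpower 2 g * / Rpower (cos d) g * exp (- g * Rabs x)) <= B * exp (- mu * Rabs x)).
    { intros g Hg. unfold B. rewrite (Rmult_assoc K (Rpower 2 nu * / Rpower (cos d) nu)). apply Rmult_le_compat_l; [lra|].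
      assert (Q1 : 0 < Rpower 2 g) by apply exp_pos.
      assert (Q2 : 0 < / Rpower (cos d) g) by (apply Rinv_0_lt_compat, exp_pos).
      assert (Q3 := exp_pos (- g * Rabs x)).
      apply Rmult_le_compat; [apply Rmult_le_pos; lra|lra| |].
      - apply Rmult_le_compat; try lra; [apply mono2; lra|].
        apply Rinv_le_contravar; auto. apply monoc; lra.
      - apply exp_le. assert (T := Rabs_pos x). nra. }
    destruct (Rlt_or_le x 0) as [Hx|Hx].
    - eapply Rle_trans; [apply (Fl x y (cos d)); auto|]. apply W; lra.
    - eapply Rle_trans; [apply (Fr x y (cos d)); auto|]. apply W; lra. }
  assert (Fd : forall x y, Rabs y < d -> cdiff F (x, y)).
  { intros x y Hy. apply cdiff_mult; [|apply cdiff_ccosh].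
    apply (cdiff_comp f csinh); [apply cdiff_csinh|]. apply cdiff_of_ex_derive, Hana. exact Hy. }
  assert (R0d : Rabs 0 < d) by (rewrite Rabs_R0; auto).
  assert (FR : forall x, F (x, 0) = (f (RtoC (sinh x)) * RtoC (cosh x))%C).
  { intros x. unfold F. rewrite csinh_real, ccosh_real. reflexivity. }
  set (phi := fun x : R => (f (RtoC (sinh x)) * RtoC (cosh x))%C).
  assert (fc : forall t, ccont f (RtoC t)).
  { intros t. rewrite <- (sinh_arcsinh t), <- csinh_real.
    apply cdiff_ccont, cdiff_of_ex_derive, Hana. exact R0d. }
  assert (phiex : forall a b, CIex phi a b).
  { intros a b. apply CIex_cont. intros x _.
    assert (Q := rcont_h F x 0 (cdiff_ccont _ _ (Fd x 0 R0d))). destruct Q as [Q1 Q2].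
    split; [apply (continuous_ext (fun t => Re (F (t, 0))))|apply (continuous_ext (fun t => Im (F (t, 0))))];
      auto; intros t; rewrite FR; reflexivity. }
  assert (phib : forall x, Cmod (phi x) <= B * exp (- mu * Rabs x)).
  { intros x. unfold phi. rewrite <- FR. apply FB; auto. }
  destruct (improper_CI phi B mu ltac:(lra) Pmu phiex phib) as [I HI].
  exists I. split.
  { apply (is_RInt_gen_sinh f B mu); auto; lra. }
  set (g := fun k : Z => (f (RtoC (sinh (IZR k * h))) * RtoC (cosh (IZR k * h)))%C).
  set (S0 := (RtoC h * sum_MN M N g)%C).
  (* Only real nodes are cut off, so no power of cos d enters; [T] becomes the summand 1 inside
     [C1]. *)
  set (T := K * Rpower 2 nu * (exp (- s) / mu + exp (- s) / mu)).
  assert (Tail : forall L, (M <= L)%nat -> (N <= L)%nat ->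
     Cmod (RtoC h * sum_MN L L g - S0)%C <= T).
  { intros L HM HN. unfold S0.
    replace L with (M + (L - M))%nat at 1 by lia.
    replace L with (N + (L - N))%nat at 2 by lia.
    assert (PK : 0 < K * Rpower 2 nu) by (apply Rmult_lt_0_compat; auto).
    eapply Rle_trans; [apply (tail_bound g h (K * Rpower 2 nu) alpha beta); auto; try lra|].
    - intros j. unfold g. rewrite <- FR, <- INR_IZR_INZ.
      assert (Pj := pos_INR j). assert (Pjh : 0 <= INR j * h) by (apply Rmult_le_pos; lra).
      eapply Rle_trans; [apply (Fr _ 0 1); auto; rewrite cos_0; lra|].
      rewrite (Rabs_pos_eq _ Pjh). replace (Rpower 1 beta) with 1.
      2:{ unfold Rpower. rewrite ln_1, Rmult_0_r, exp_0. auto. }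
      rewrite Rinv_1, Rmult_1_r, <- Rmult_assoc. apply Rmult_le_compat_r; [left; apply exp_pos|].
      apply Rmult_le_compat_l; [lra|apply mono2; auto].
    - intros j. unfold g. rewrite <- FR, opp_IZR, <- INR_IZR_INZ.
      assert (Pj := pos_INR j). assert (Pjh : 0 < INR (S j) * h) by (apply Rmult_lt_0_compat; auto; rewrite S_INR; lra).
      eapply Rle_trans; [apply (Fl _ 0 1); auto; [lra|rewrite cos_0; lra]|].
      replace (- INR (S j) * h) with (- (INR (S j) * h)) by ring.
      rewrite Rabs_Ropp, (Rabs_pos_eq _ (Rlt_le _ _ Pjh)). replace (Rpower 1 alpha) with 1.
      2:{ unfold Rpower. rewrite ln_1, Rmult_0_r, exp_0. auto. }
      rewrite Rinv_1, Rmult_1_r, <- Rmult_assoc. apply Rmult_le_compat_r; [left; apply exp_pos|].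
      apply Rmult_le_compat_l; [lra|apply mono2; auto].
    - destruct (trunc_spec alpha beta n Hal Hbe) as [S1 S2]. fold mu M N in S1, S2.
      apply Rmult_le_compat_l; [lra|].
      assert (Pes := exp_pos (- s)).
      apply Rplus_le_compat; unfold Rdiv; apply Rmult_le_compat; try (left; apply exp_pos);
        try (left; apply Rinv_0_lt_compat; auto); try (apply Rinv_le_contravar; auto);
        apply exp_le; rewrite <- Es.
      + assert (mu * INR n * h <= alpha * INR M * h) by (apply Rmult_le_compat_r; lra). lra.
      + assert (mu * INR n * h <= beta * INR N * h) by (apply Rmult_le_compat_r; lra). lra. }
  assert (Main : forall e, 0 < e < d -> Cmod (I - S0) - T <= 4 * B / mu * / (exp (2 * PI / h * e) - 1)).
  { intros e He. apply le_epsilon. intros eps Heps.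
    (* Collects everything that vanishes as the cells exhaust the line: the two tails of the
       integral and the two outermost vertical sides. *)
    set (C0 := 2 * (B / mu) + 6 * e * B).
    assert (PBm : 0 < B / mu) by (apply Rdiv_lt_0_compat; auto).
    assert (PC0 : 0 < C0).
    { unfold C0. assert (0 < e * B) by (apply Rmult_lt_0_compat; lra). lra. }
    destruct (exp_decay_small C0 mu eps) as [X [PX HX]]; try lra.
    destruct (nfloor_ex (X / h)) as [L0 [_ HL0]].
    { left; apply Rdiv_lt_0_compat; auto. }
    (* Large enough to contain the truncated sum and to push the last cell boundary beyond [X]. *)
    set (L := (S L0 + M + N)%nat).
    assert (HL : X / h <= INR L + 1 / 2).
    { assert (INR (S L0) <= INR L) by (apply le_INR; unfold L; lia). rewrite S_INR in H. lra. }
    assert (Xl : X <= (INR L + 1 / 2) * h).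
    { apply Rmult_le_compat_r with (r := h) in HL; [|lra].
      replace (X / h * h) with X in HL by (field; lra). auto. }
    assert (TE := trapezoid_error F h e B mu Ph ltac:(lra) ltac:(lra) Pmu).
    specialize (TE ltac:(intros; apply Fd; apply Rabs_def1; lra)).
    specialize (TE ltac:(intros; apply FB; apply Rabs_def1; lra) L). cbv zeta in TE.
    set (Y := (INR L + 1 / 2) * h) in *.
    assert (IY := HI Y Y ltac:(lra) ltac:(lra)).
    assert (ES : sum_MN L L (fun k : Z => F (RtoC (IZR k * h))) = sum_MN L L g).
    { unfold sum_MN. apply sum_n_ext. intros j. unfold g. rewrite <- FR. reflexivity. }
    rewrite ES in TE.
    rewrite (CI_ext (fun x => F (x, 0)) phi) in TE by (intros; apply FR).
    assert (TL := Tail L ltac:(unfold L; lia) ltac:(unfold L; lia)).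
    specialize (HX Y Xl).
    assert (Tri : Cmod (I - S0) <= Cmod (I - CI phi (- Y) Y)
       + Cmod (RtoC h * sum_MN L L g - CI phi (- Y) Y) + Cmod (RtoC h * sum_MN L L g - S0)).
    { replace (I - S0)%C with ((I - CI phi (- Y) Y) - (RtoC h * sum_MN L L g - CI phi (- Y) Y)
        + (RtoC h * sum_MN L L g - S0))%C by ring.
      eapply Rle_trans; [apply Cmod_triangle|]. apply Rplus_le_compat_r. apply Cmod_sum_le. }
    unfold C0 in HX.
    replace (4 * B / mu * / (exp (2 * PI / h * e) - 1)) with (4 * B * / (exp (2 * PI / h * e) - 1) / mu) by (unfold Rdiv; ring).
    lra. }
  assert (Pw : 0 < 2 * PI / h) by (apply Rdiv_lt_0_compat; lra).
  assert (Lim := le_inv_exp_limit _ (4 * B / mu) _ d Pw Hd ltac:(apply Rdiv_lt_0_compat; lra) Main).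
  rewrite Es2 in Lim.
  set (s0 := sqrt (2 * PI * d * mu)) in *.
  assert (Pdm : 0 < 2 * PI * d * mu) by (apply Rmult_lt_0_compat; [apply Rmult_lt_0_compat|]; lra).
  assert (Ps0 : 0 < s0) by (apply sqrt_lt_R0; auto).
  assert (Hs0 : s0 <= s).
  { apply sqrt_le_1_alt. rewrite <- (Rmult_1_r (2 * PI * d * mu)) at 1. apply Rmult_le_compat_l; lra. }
  assert (E1 : exp (- s0) < 1) by (rewrite <- exp_0; apply exp_increasing; lra).
  assert (E2 : exp (- s) <= exp (- s0)) by (apply exp_le; lra).
  (* The left-hand side is e^(-s) / (1 - e^(-s)); replacing [s] by [s0] in the denominator alone
     makes the constant independent of n. *)
  assert (E3 : / (exp s - 1) <= exp (- s) * / (1 - exp (- s0))).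
  { replace (/ (exp s - 1)) with (exp (- s) * / (1 - exp (- s))).
    - apply Rmult_le_compat_l; [left; apply exp_pos|]. apply Rinv_le_contravar; lra.
    - rewrite exp_Ropp. assert (1 < exp s) by (rewrite <- exp_0; apply exp_increasing; lra).
      field. lra. }
  assert (E4 : 4 * B / mu * / (exp s - 1) <= 4 * B / mu * (exp (- s) * / (1 - exp (- s0)))).
  { apply Rmult_le_compat_l; auto. left; apply Rdiv_lt_0_compat; lra. }
  apply Rle_trans with (4 * B / mu * (exp (- s) * / (1 - exp (- s0))) + T); [lra|].
  right. unfold C1, T, B. rewrite Rpower_plus, Rpower_1 by lra. fold s0. field. lra.
Qed.
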